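(* The Restricted Items Selection Problem (RIS) can be solved in polynomial time in each of the following special cases: (1) each item appears in at most one constraint (tuple) of $T$; (2) the forbiddance relation is transitive, i.e., whenever $(i,k,j,l)\in T$ and $(j,l,p,q)\in T$, then $(i,k,p,q)\in T$.
   Context: Restricted Items Selection Problem (RIS): given are $m$ finite sets $I_1,\ldots,I_m$ of items, $r_i = |I_i|$, the items of $I_i$ indexed $1,\ldots,r_i$, with an integer cost $c_{ij}$ for each item $j$ of set $i$; a set $T$ of ''forbidden pairs'', i.e. tuples $(i,k,j,l)$ with $i,j \in \{1,\ldots,m\}$, $k \in I_i$, $l \in I_j$, meaning that item $k$ of set $i$ and item $l$ of set $j$ cannot both be selected; and positive integers $p_i < |I_i|$. With binary variables $x_{ij}$ ($x_{ij}=1$ iff item $j$ of set $i$ is selected), the problem is to minimize $\sum_{i=1}^m\sum_{j=1}^{r_i} c_{ij}x_{ij}$ subject to $\sum_{j=1}^{r_i} x_{ij} = p_i$ for all $i$, $x_{ik}+x_{jl}\le 1$ for all $(i,k,j,l)\in T$, and $x_{ij}\in\{0,1\}$ (i.e., find an optimal feasible selection or report infeasibility).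
   Formalization: In (2), transitivity is required of the symmetric relation ''cannot both be selected'' (the symmetric closure of T), and only between distinct end items; transitivity of T as ordered tuples can hold vacuously and then encodes SAT, making the literal claim NP-hard. *)

(* Defs.v *)
From mathcomp Require Import all_boot all_order all_algebra.

Set Implicit Arguments.
Unset Strict Implicit.
Unset Printing Implicit Defensive.

Import Order.TTheory GRing.Theory Num.Theory.
Local Open Scope ring_scope.

(* The model of computation is the random access machine of Cook and Reckhow,
   "Time bounded random access machines" (1973).  The registers hold
   integers, the input is a stream of integers consumed by Read, and the output
   is the stream of printed integers.  Every instruction has cost 1.  The only
   arithmetic is addition and subtraction, so n steps lengthen the numbers
   involved by at most n bits; this is why unit-cost polynomial time on this
   machine is polynomial time on Turing machines. *)

Variant instr :=
  | Const (i : int) (c : int)    (* X_i := c                             *)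
  | Plus  (i j k : int)          (* X_i := X_j + X_k                     *)
  | Minus (i j k : int)          (* X_i := X_j - X_k                     *)
  | Fetch (i j : int)            (* X_i := X_(X_j)                       *)
  | Store (i j : int)            (* X_(X_i) := X_j                       *)
  | Jpos  (l : nat) (j : int)    (* goto instruction l if X_j > 0        *)
  | Read  (i : int)              (* X_i := next input (0 if none is left) *)
  | Print (i : int).             (* append X_i to the output             *)

(* Registers are indexed by all of int so that indirect addressing is total. *)
Record config := Config {
  pc   : nat;
  regs : int -> int;
  inp  : seq int;
  out  : seq int
}.

Definition step (P : seq instr) (s : config) : config :=
  let: Config l X a b := s in
  match onth P l with
  | None => s
  | Some (Const i c) => Config l.+1 [eta X with i |-> c] a b
  | Some (Plus i j k)  => Config l.+1 [eta X with i |-> X j + X k] a b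
  | Some (Minus i j k) => Config l.+1 [eta X with i |-> X j - X k] a b
  | Some (Fetch i j) => Config l.+1 [eta X with i |-> X (X j)] a b
  | Some (Store i j) => Config l.+1 [eta X with X i |-> X j] a b
  | Some (Jpos l' j) => Config (if 0 < X j then l' else l.+1) X a b
  | Some (Read i)    => Config l.+1 [eta X with i |-> head 0 a] (behead a) b
  | Some (Print i)   => Config l.+1 X a (rcons b (X i))
  end.

Definition init (a : seq int) : config := Config 0 (fun=> 0) a [::].

(* The machine halts when pc leaves the program; a halted configuration is a
   fixed point of step, so this means halting after at most n steps. *)
Definition halts_within (P : seq instr) (a : seq int) (n : nat)
    (b : seq int) : Prop :=
  let s := iter n (step P) (init a) in (size P <= pc s)%N /\ out s = b.

(* Length of the binary representation, with one extra symbol for a minus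
   sign; 0 has length 1. *)
Definition bitlen (z : int) : nat := ((z < 0)%R + (trunc_log 2 `|z|).+1)%N.

Definition input_size (a : seq int) : nat := (\sum_(z <- a) bitlen z)%N.

(* The computational problem with instances I : X, given to the machine as
   enc I and having the correct answers b such that ans I b, is solvable in
   polynomial time when restricted to the instances satisfying C. *)
Definition polytime_solvable (X : Type) (enc : X -> seq int)
    (ans : X -> seq int -> Prop) (C : X -> Prop) : Prop :=
  exists (P : seq instr) (q : {poly nat}), forall I : X, C I ->
  exists2 b : seq int, halts_within P (enc I) q.[input_size (enc I)] b & ans I b.

(* Sets and items are numbered from 0. *)
Record ris := RIS {
  nsets  : nat;
  nitems : 'I_nsets -> nat;
  cost   : forall i : 'I_nsets, 'I_(nitems i) -> int;
  forbid : {set {i : 'I_nsets & 'I_(nitems i)} * {i : 'I_nsets & 'I_(nitems i)}};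
  npick  : 'I_nsets -> nat;
  npickP : forall i : 'I_nsets, (0 < npick i < nitems i)%N
}.

Definition item (I : ris) := {i : 'I_(nsets I) & 'I_(nitems i)}.

Definition selection (I : ris) := forall i : 'I_(nsets I), 'I_(nitems i) -> bool.

Definition feasible (I : ris) (x : selection I) : Prop :=
  (forall i : 'I_(nsets I), (\sum_(j < nitems i) x i j = npick i)%N) /\
  (forall a b : item I, (a, b) \in forbid I ->
     (x (tag a) (tagged a) + x (tag b) (tagged b) <= 1)%N).

Definition value (I : ris) (x : selection I) : int :=
  \sum_(i < nsets I) \sum_(j < nitems i) cost j * (x i j)%:Z.

Definition optimal (I : ris) (x : selection I) : Prop :=
  feasible x /\ forall y : selection I, feasible y -> value x <= value y.

Definition enc_item (I : ris) (a : item I) : seq int :=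
  [:: (val (tag a))%:Z; (val (tagged a))%:Z].

(* m, then r_i, p_i, c_i1, ..., c_ir_i for each set i, then |T| and the tuples
   (i, k, j, l) of T. *)
Definition enc_ris (I : ris) : seq int :=
  (nsets I)%:Z ::
  flatten [seq [:: (nitems i)%:Z, (npick i)%:Z
                 & [seq cost j | j <- enum 'I_(nitems i)]]
          | i <- enum 'I_(nsets I)] ++
  #|forbid I|%:Z ::
  flatten [seq enc_item t.1 ++ enc_item t.2 | t <- enum (forbid I)].

Definition enc_selection (I : ris) (x : selection I) : seq int :=
  flatten [seq [seq (x i j : nat)%:Z | j <- enum 'I_(nitems i)]
          | i <- enum 'I_(nsets I)].

(* The answer is 1 followed by the x_ij of an optimal solution, or the single
   number 0 to report infeasibility. *)
Definition ris_answer (I : ris) (b : seq int) : Prop :=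
  (exists2 x : selection I, optimal x & b = 1 :: enc_selection x) \/
  ((forall x : selection I, ~ feasible x) /\ b = [:: 0]).

Definition at_most_one_tuple (I : ris) : Prop :=
  forall a : item I,
    (#|[set t in forbid I | (a == t.1) || (a == t.2)]| <= 1)%N.

(* A tuple (i, k, j, l) forbids an unordered pair of items, so the forbiddance
   relation is the symmetric closure of T. *)
Definition forbidden (I : ris) (a b : item I) : bool :=
  ((a, b) \in forbid I) || ((b, a) \in forbid I).

(* Since forbidden is symmetric, transitivity can only be asked for a != c:
   with a = c it would make every item occurring in T forbidden with itself,
   i.e. never selectable. *)
Definition forbidden_transitive (I : ris) : Prop :=
  forall a b c : item I, a != c ->
    forbidden a b -> forbidden b c -> forbidden a c.

(* Main.v *)
Require Import Defs.
From mathcomp Require Import all_boot all_order all_algebra.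
From mathcomp Require Import zify ring.

Set Implicit Arguments.
Unset Strict Implicit.
Unset Printing Implicit Defensive.

Import Order.TTheory GRing.Theory Num.Theory.
Local Open Scope ring_scope.

(* If every item occurs in at most one tuple, two distinct items forbidden with
   a common third one would put that item in two tuples, so transitivity holds
   vacuously and (1) is a case of (2).

   Under (2) the forbiddance relation partitions the items into cliques, and a
   selection takes at most one item of each clique.  Choosing p_i items of each
   set i, at most one per clique and no item forbidden with itself, is a
   minimum-cost transportation problem with sets on one side and cliques
   ("columns") on the other; it is solved by the primal-dual (Hungarian) method.
   Potentials u of the sets and v <= 0 of the columns with u + v <= c on every
   item, equality on the chosen ones and v = 0 on the free columns certify
   optimality.  To serve one more unit of a set, the root, one grows a tree of
   tight items; each marked set carries the whole matching obtained by rerouting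
   along its tree path, so that an augmentation is a single copy and no path is
   ever followed backwards.  If the tree gets stuck, Hall's count shows that
   there is no feasible selection.

   The algorithm is written in a language whose only loops are bounded, so its
   running time on the machine is at most a polynomial in any common bound of
   the loop limits, and the input size is such a bound. *)

(** * A language of bounded loops and its compiler *)

Inductive exp :=
  | Lit of int
  | Get of nat & exp
  | Add of exp & exp
  | Dif of exp & exp.

Inductive cmd :=
  | Skip
  | Put of nat & exp & exp
  | Input of nat & exp
  | Output of exp
  | Seq of cmd & cmd
  | If of exp & cmd & cmd
  | For of nat & nat & cmd.

(** A scalar variable is the cell at index 0 of its array, so that scalars and arrays share one kind
    of memory. *)
Definition Var (A : nat) : exp := Get A (Lit 0).

Record state := State {
  mem :> nat -> int -> int;
  sinp : seq int;
  sout : seq int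
}.

Definition upd (s : state) (A : nat) (z w : int) : state :=
  State (fun B y => if (B == A) && (y == z) then w else s B y) (sinp s) (sout s).

Fixpoint ev (e : exp) (s : state) : int :=
  match e with
  | Lit z => z
  | Get A e => s A (ev e s)
  | Add e f => ev e s + ev f s
  | Dif e f => ev e s - ev f s
  end.

Definition nats (z : int) : nat := if z is Posz n then n else 0.

(** The limit of a loop is read once, on entry, and counts as 0 if negative; the counter ends with
    the value at which the compiled test fails. *)
Fixpoint run (c : cmd) (s : state) : state :=
  match c with
  | Skip => s
  | Put A e f => upd s A (ev e s) (ev f s)
  | Input A e =>
      upd (State s (behead (sinp s)) (sout s)) A (ev e s) (head 0 (sinp s))
  | Output e => State s (sinp s) (rcons (sout s) (ev e s))
  | Seq c d => run d (run c s)
  | If e c d => if 0 < ev e s then run c s else run d s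
  | For i N c =>
      upd (iteri (nats (s N 0)) (fun k s => run c (upd s i 0 k%:Z)) s)
          i 0 (nats (s N 0))%:Z
  end.

Definition for_state i c s k := iteri k (fun k s => run c (upd s i 0 k%:Z)) s.

Fixpoint writes (c : cmd) (A : nat) : bool :=
  match c with
  | Skip | Output _ => false
  | Put B _ _ | Input B _ => A == B
  | Seq c d | If _ c d => writes c A || writes d A
  | For i _ c => (A == i) || writes c A
  end.

(** For a concrete program [writes] computes, so the hypothesis is closed by conversion. Throughout,
    facts about arrays that a piece of program leaves alone are carried across it in this way. *)
Lemma run_frame c s A z : ~~ writes c A -> run c s A z = s A z.
Proof.
elim: c s => //= [B e f|B e|c IHc d IHd|e c IHc d IHd|i N c IHc] s.
- by move/negPf->.
- by move/negPf->.
- by rewrite negb_or => /andP[hc hd]; rewrite IHd ?IHc.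
- by rewrite negb_or => /andP[hc hd]; case: ifP; rewrite ?IHd ?IHc.
- rewrite negb_or => /andP[/negPf hi hc]; rewrite hi /=.
  by elim: (nats _) => //= k IHk; rewrite IHc //= hi.
Qed.

(* Identifier A at index z lives in register 64 z + A, so that
   distinct identifiers never alias; identifier 0 is reserved for temporaries. *)
Definition addr (A : nat) (z : int) : int := z * 64 + A%:Z.
Definition tmp (d : nat) : int := addr 0 d%:Z.

(* Locked because simplification would unfold this literal list under cat. *)
Definition cadr : nat -> nat -> seq instr := locked (fun d A =>
  nseq 6 (Plus (tmp d) (tmp d) (tmp d)) ++
  [:: Const (tmp d.+1) A%:Z; Plus (tmp d) (tmp d) (tmp d.+1)]).

(** [d] is the height of an evaluation stack: the value goes to [tmp d], and only temporaries from
    [d] on are overwritten. *)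
Fixpoint cexp (d : nat) (e : exp) : seq instr :=
  match e with
  | Lit z => [:: Const (tmp d) z]
  | Get A e => cexp d e ++ cadr d A ++ [:: Fetch (tmp d) (tmp d)]
  | Add e f => cexp d e ++ cexp d.+1 f ++ [:: Plus (tmp d) (tmp d) (tmp d.+1)]
  | Dif e f => cexp d e ++ cexp d.+1 f ++ [:: Minus (tmp d) (tmp d) (tmp d.+1)]
  end.

Definition cput (A : nat) (e f : exp) : seq instr :=
  cexp 0 e ++ cadr 0 A ++ cexp 1 f ++ [:: Store (tmp 0) (tmp 1)].

(** [l] is the address at which the code will stand, since jump targets are absolute. In a
    conditional the negative branch comes first and [Jpos] skips it. *)
Fixpoint compile (l : nat) (c : cmd) : seq instr :=
  match c with
  | Skip => [::]
  | Put A e f => cput A e f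
  | Input A e =>
      cexp 0 e ++ cadr 0 A ++ [:: Read (tmp 1); Store (tmp 0) (tmp 1)]
  | Output e => cexp 0 e ++ [:: Print (tmp 0)]
  | Seq c d => let p := compile l c in p ++ compile (l + size p) d
  | If e c d =>
      let h := cexp 0 e in
      let q := compile (l + size h + 1) d in
      let l1 := (l + size h + 1 + size q + 2)%N in
      let p := compile l1 c in
      h ++ [:: Jpos l1 (tmp 0)] ++ q ++
      [:: Const (tmp 0) 1; Jpos (l1 + size p) (tmp 0)] ++ p
  | For i N c =>
      let h0 := cput i (Lit 0) (Lit 0) in
      let top := (l + size h0)%N in
      let h := cexp 0 (Dif (Var N) (Var i)) in
      let l1 := (top + size h + 3)%N in
      let p := compile l1 c in
      let h1 := cput i (Lit 0) (Add (Var i) (Lit 1)) in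
      h0 ++ h ++
      [:: Jpos l1 (tmp 0); Const (tmp 0) 1;
          Jpos (l1 + size p + size h1 + 2) (tmp 0)] ++ p ++ h1 ++
      [:: Const (tmp 0) 1; Jpos top (tmp 0)]
  end.

Definition wf_id (A : nat) := (0 < A < 64)%N.

Fixpoint wf_exp (e : exp) : bool :=
  match e with
  | Lit _ => true
  | Get A e => wf_id A && wf_exp e
  | Add e f | Dif e f => wf_exp e && wf_exp f
  end.

(** The conditions on [For] make the compiled test, which compares the current counter and limit,
    agree with the iteration count fixed on entry. *)
Fixpoint wf_cmd (c : cmd) : bool :=
  match c with
  | Skip => true
  | Put A e f => [&& wf_id A, wf_exp e & wf_exp f]
  | Input A e => wf_id A && wf_exp e
  | Output e => wf_exp e
  | Seq c d => wf_cmd c && wf_cmd d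
  | If e c d => [&& wf_exp e, wf_cmd c & wf_cmd d]
  | For i N c =>
      [&& wf_id i, wf_id N, i != N, ~~ writes c i, ~~ writes c N & wf_cmd c]
  end.

Fixpoint loops_le (B : nat) (c : cmd) (s : state) : Prop :=
  match c with
  | Skip | Put _ _ _ | Input _ _ | Output _ => True
  | Seq c d => loops_le B c s /\ loops_le B d (run c s)
  | If e c d => if 0 < ev e s then loops_le B c s else loops_le B d s
  | For i N c =>
      (nats (s N 0%R) <= B)%N /\
      forall k, (k < nats (s N 0%R))%N ->
        loops_le B c (upd (for_state i c s k) i 0 k%:Z)
  end.

(** Charging both branches of a conditional makes the bound depend on the command and on [B]
    alone. *)
Fixpoint time_bound (c : cmd) (B : nat) : nat :=
  match c with
  | Seq c d => time_bound c B + time_bound d B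
  | If e c d => size (cexp 0 e) + 3 + (time_bound c B + time_bound d B)
  | For i N c =>
      size (cput i (Lit 0) (Lit 0)) +
      B * (size (cexp 0 (Dif (Var N) (Var i))) + 5 + time_bound c B +
           size (cput i (Lit 0) (Add (Var i) (Lit 1)))) +
      (size (cexp 0 (Dif (Var N) (Var i))) + 3)
  | _ => size (compile 0 c)
  end%N.

(** * Correctness and running time of compiled code *)

Definition code_at (P : seq instr) (l : nat) (p : seq instr) :=
  forall k, (k < size p)%N -> onth P (l + k) = onth p k.

Lemma code_at_cat P l p q :
  code_at P l (p ++ q) <-> code_at P l p /\ code_at P (l + size p) q.
Proof.
split=> [h|[hp hq] k].
  split=> k hk; first by rewrite h ?onth_cat ?hk // size_cat; lia.
  by rewrite -addnA h ?onth_cat ?size_cat; [case: ifP; [lia|rewrite addKn]|lia].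
rewrite size_cat onth_cat => hk; case: ifP => h; first exact: hp.
by have := hq (k - size p)%N; rewrite -addnA subnKC; [apply; lia|lia].
Qed.

Lemma code_at_cons P l i p :
  code_at P l (i :: p) <-> onth P l = Some i /\ code_at P l.+1 p.
Proof.
rewrite -cat1s code_at_cat /= addn1; split=> -[h hp]; split=> //.
  by have := h 0 isT; rewrite addn0.
by case=> //= _; rewrite addn0.
Qed.

Lemma code_at_loop P l p0 p1 x y z p2 p3 u v :
  code_at P l (p0 ++ p1 ++ [:: x; y; z] ++ p2 ++ p3 ++ [:: u; v]) ->
  let l0 := (l + size p0)%N in
  let l1 := (l0 + size p1)%N in
  let l2 := (l1 + 3)%N in
  let l3 := (l2 + size p2)%N in
  let l4 := (l3 + size p3)%N in
  [/\ code_at P l p0, code_at P l0 p1,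
      [/\ onth P l1 = Some x, onth P l1.+1 = Some y & onth P l1.+2 = Some z],
      code_at P l2 p2 /\ code_at P l3 p3 &
      onth P l4 = Some u /\ onth P l4.+1 = Some v].
Proof.
rewrite !code_at_cat !code_at_cons.
by case=> [h0 [h1 [[hx [hy [hz _]]] [h2 [h3 [hu [hv _]]]]]]].
Qed.

Definition runs (P : seq instr) (s t : config) (n : nat) : Prop :=
  exists2 k, (k <= n)%N & iter k (step P) s = t.

Lemma runs_refl P s : runs P s s 0.
Proof. by exists 0. Qed.

Lemma runs_trans P s t u m n : runs P s t m -> runs P t u n -> runs P s u (m + n).
Proof.
case=> k hk <- [k' hk' <-]; exists (k + k')%N; first exact: leq_add.
by rewrite addnC iterD.
Qed.

Lemma runs_step P s t n : runs P (step P s) t n -> runs P s t n.+1.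
Proof. by case=> k hk <-; exists k.+1 => //; rewrite iterSr. Qed.

Lemma runs_one P s t : step P s = t -> runs P s t 1.
Proof. by exists 1%N. Qed.

Lemma runs_le P s t m n : runs P s t m -> (m <= n)%N -> runs P s t n.
Proof. by case=> k hk e hn; exists k => //; apply: leq_trans hn. Qed.

Definition agree (X : int -> int) (s : state) : Prop :=
  forall A z, wf_id A -> X (addr A z) = s A z.

(** Evaluation at height [d] may destroy the temporaries from [d] on; those below hold operands
    still to be used. *)
Definition same_below (d : nat) (X Y : int -> int) : Prop :=
  forall z, (forall d', (d <= d')%N -> z <> tmp d') -> Y z = X z.

Lemma same_below_trans d X Y Z :
  same_below d X Y -> same_below d Y Z -> same_below d X Z.
Proof. by move=> h1 h2 z hz; rewrite h2 ?h1. Qed.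

Lemma same_below_le d d' X Y : (d <= d')%N -> same_below d' X Y -> same_below d X Y.
Proof. by move=> hd h z hz; apply: h => d2 hd2; apply: hz; lia. Qed.

Lemma same_below_tmp d d' X Y : (d' < d)%N -> same_below d X Y ->
  Y (tmp d') = X (tmp d').
Proof. by move=> hd h; apply: h => d2 hd2; rewrite /tmp /addr; lia. Qed.

Lemma same_below_upd d d' X z : (d <= d')%N ->
  same_below d X [eta X with tmp d' |-> z].
Proof. by move=> hd y hy /=; case: eqP => // e; case: (hy _ hd). Qed.

Lemma agree_below d X Y s : same_below d X Y -> agree X s -> agree Y s.
Proof.
move=> h hX A z hA; rewrite h ?hX // => d' _.
by rewrite /tmp /addr; move: hA; rewrite /wf_id; lia.
Qed.

Lemma tmp_eq d d' : (tmp d == tmp d') = (d == d').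
Proof. by apply/eqP/eqP => [|-> //]; rewrite /tmp /addr; lia. Qed.

(** The machine cannot multiply; six doublings produce the factor 64 of [addr]. *)
Lemma double_ok P k l d X a b :
  code_at P l (nseq k (Plus (tmp d) (tmp d) (tmp d))) ->
  exists Y, [/\ runs P (Config l X a b) (Config (l + k) Y a b) k,
                Y (tmp d) = X (tmp d) * (2 ^ k)%N%:Z & same_below d X Y].
Proof.
elim: k l X => [|k IHk] l X; first by exists X; rewrite addn0 mulr1; split=> //; apply: runs_refl.
rewrite /= code_at_cons => -[h0 hk].
have [Y [rY vY sY]] := IHk l.+1 [eta X with tmp d |-> X (tmp d) + X (tmp d)] hk.
exists Y; split.
- by rewrite addnS -addSn; apply: runs_step; rewrite {1}/step h0.
- by rewrite vY /= eqxx expnS; lia.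
- exact: same_below_trans (same_below_upd _ _ (leqnn d)) sY.
Qed.

Lemma cadr_ok P l d A X a b : code_at P l (cadr d A) ->
  exists Y, [/\ runs P (Config l X a b) (Config (l + size (cadr d A)) Y a b)
                  (size (cadr d A)),
                Y (tmp d) = addr A (X (tmp d)) & same_below d X Y].
Proof.
rewrite /cadr -lock code_at_cat => -[h]; rewrite size_nseq !code_at_cons.
case=> h0 [h1 _].
have [Y [rY vY sY]] := double_ok X a b h.
exists [eta [eta Y with tmp d.+1 |-> A%:Z] with tmp d |-> Y (tmp d) + A%:Z].
split.
- rewrite size_cat size_nseq addnA; apply: (runs_trans rY).
  apply: runs_step; rewrite {1}/step h0.
  apply: runs_step; rewrite {1}/step h1 /= eqxx !tmp_eq ltn_eqF // addn2.
  exact: runs_refl.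
- by rewrite /= eqxx vY.
- apply: same_below_trans sY _.
  apply: same_below_trans (same_below_upd _ _ (leqnSn d)) _.
  exact: same_below_upd.
Qed.

Lemma cexp_ok P l d e X a b s : code_at P l (cexp d e) -> wf_exp e -> agree X s ->
  exists Y, [/\ runs P (Config l X a b) (Config (l + size (cexp d e)) Y a b)
                  (size (cexp d e)),
                Y (tmp d) = ev e s & same_below d X Y].
Proof.
elim: e l d X => [z|A e IH|e IHe f IHf|e IHe f IHf] l d X.
- rewrite /= code_at_cons => -[h _] _ _; eexists; split.
  + by apply: runs_step; rewrite {1}/step h addn1; apply: runs_refl.
  + by rewrite /= eqxx.
  + exact: same_below_upd.
- rewrite /= code_at_cat code_at_cat !code_at_cons /= => -[he [hA [hF _]]] /andP[wA we] ag.
  have [Y [rY vY sY]] := IH _ _ _ he we ag.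
  have [Z [rZ vZ sZ]] := cadr_ok Y a b hA.
  eexists; split.
  + rewrite !size_cat /= !addnA addn1.
    apply: runs_le (runs_trans rY (runs_trans rZ (runs_one _))) _; last by lia.
    by rewrite /step hF.
  + rewrite /= eqxx vZ vY (agree_below (same_below_trans sY sZ) ag) //.
  + apply: (same_below_trans sY); apply: (same_below_trans sZ).
    exact: same_below_upd.
- rewrite /= !code_at_cat !code_at_cons => -[he [hf [hP _]]] /andP[we wf] ag.
  have [Y [rY vY sY]] := IHe _ _ _ he we ag.
  have [Z [rZ vZ sZ]] := IHf _ _ _ hf wf (agree_below sY ag).
  eexists; split.
  + rewrite !size_cat /= !addnA addn1.
    apply: runs_le (runs_trans rY (runs_trans rZ (runs_one _))) _; last by lia.
    by rewrite /step hP.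
  + by rewrite /= eqxx vZ (same_below_tmp _ sZ) // vY.
  + apply: (same_below_trans sY); apply: (same_below_trans (same_below_le (leqnSn _) sZ)).
    exact: same_below_upd.
- rewrite /= !code_at_cat !code_at_cons => -[he [hf [hP _]]] /andP[we wf] ag.
  have [Y [rY vY sY]] := IHe _ _ _ he we ag.
  have [Z [rZ vZ sZ]] := IHf _ _ _ hf wf (agree_below sY ag).
  eexists; split.
  + rewrite !size_cat /= !addnA addn1.
    apply: runs_le (runs_trans rY (runs_trans rZ (runs_one _))) _; last by lia.
    by rewrite /step hP.
  + by rewrite /= eqxx vZ (same_below_tmp _ sZ) // vY.
  + apply: (same_below_trans sY); apply: (same_below_trans (same_below_le (leqnSn _) sZ)).
    exact: same_below_upd.
Qed.

Lemma agree_upd X s A z w : agree X s -> wf_id A ->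
  agree [eta X with addr A z |-> w] (upd s A z w).
Proof.
move=> ag wA B y wB /=; rewrite -ag //; congr (if _ then _ else _).
apply/eqP/andP => [|[/eqP-> /eqP->] //].
by move: wA wB; rewrite /wf_id /addr => *; split; apply/eqP; lia.
Qed.

Lemma cput_ok P l A e f X s : code_at P l (cput A e f) ->
  wf_id A -> wf_exp e -> wf_exp f -> agree X s ->
  exists2 Y,
    runs P (Config l X (sinp s) (sout s))
      (Config (l + size (cput A e f)) Y (sinp s) (sout s)) (size (cput A e f)) &
    agree Y (upd s A (ev e s) (ev f s)).
Proof.
rewrite /cput !code_at_cat !code_at_cons => -[he [hA [hf [hS _]]]] wA we wf ag.
have [Y [rY vY sY]] := cexp_ok (sinp s) (sout s) he we ag.
have [Z [rZ vZ sZ]] := cadr_ok Y (sinp s) (sout s) hA.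
have agZ : agree Z s by apply: agree_below ag; apply: same_below_trans sY sZ.
have [W [rW vW sW]] := cexp_ok (sinp s) (sout s) hf wf agZ.
eexists.
  rewrite !size_cat /= !addnA addn1.
  have r := runs_trans rY (runs_trans rZ (runs_trans rW (runs_one _))).
  by apply: runs_le (r _ _) _; [rewrite /step hS | lia].
rewrite (same_below_tmp _ sW) // vZ vY vW; apply: agree_upd => //.
exact: agree_below sW agZ.
Qed.

Arguments cexp : simpl never.
Arguments cput : simpl never.

Definition for_init i := cput i (Lit 0) (Lit 0).
Definition for_test i N := cexp 0 (Dif (Var N) (Var i)).
Definition for_next i := cput i (Lit 0) (Add (Var i) (Lit 1)).

Lemma time_bound_For i N c B : time_bound (For i N c) B =
  (size (for_init i) + B * (size (for_test i N) + 5 + time_bound c B + size (for_next i)) +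
   (size (for_test i N) + 3))%N.
Proof. by []. Qed.

Lemma compile_For l i N c : compile l (For i N c) =
  let top := (l + size (for_init i))%N in
  let l1 := (top + size (for_test i N) + 3)%N in
  let p := compile l1 c in
  for_init i ++ for_test i N ++
  [:: Jpos l1 (tmp 0); Const (tmp 0) 1;
      Jpos (l1 + size p + size (for_next i) + 2) (tmp 0)] ++ p ++ for_next i ++
  [:: Const (tmp 0) 1; Jpos top (tmp 0)].
Proof. by []. Qed.

(** A sum is bounded by a product of positive factors, so exponents can simply be added under
    composition; a loop raises the degree by one. *)
Lemma time_bound_poly c : exists a d, forall B, (0 < B)%N -> (time_bound c B <= a * B ^ d)%N.
Proof.
have mulB (a b x y B t : nat) : (x <= a * t -> 0 < t -> y <= b * B -> 0 < B ->
  x + y <= (a + b) * (t * B))%N.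
  move=> hx t0 hy B0; rewrite mulnDl; apply: leq_add.
    by apply: leq_trans hx _; rewrite leq_mul2l leq_pmulr ?orbT.
  by apply: leq_trans hy _; rewrite leq_mul2l leq_pmull ?orbT.
elim: c => [|A e f|A e|e|c [a1 [d1 h1]] d [a2 [d2 h2]]
           |e c [a1 [d1 h1]] d [a2 [d2 h2]]|i N c [a1 [d1 h1]]].
- by exists 0, 0.
- by exists (time_bound (Put A e f) 0), 0 => B _; rewrite expn0 muln1.
- by exists (time_bound (Input A e) 0), 0 => B _; rewrite expn0 muln1.
- by exists (time_bound (Output e) 0), 0 => B _; rewrite expn0 muln1.
- exists (a1 + a2)%N, (d1 + d2)%N => B B0 /=.
  by rewrite expnD; apply: mulB; rewrite ?expn_gt0 ?B0 // (h1, h2).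
- exists (size (cexp 0 e) + 3 + (a1 + a2))%N, (d1 + d2)%N => B B0 /=.
  rewrite mulnDl leq_add ?leq_pmulr ?expn_gt0 ?B0 // expnD.
  by apply: mulB; rewrite ?expn_gt0 ?B0 // (h1, h2).
- set x := size (for_init i); set y := size (for_test i N).
  set z := size (for_next i).
  exists (x + (y + 5 + a1 + z) + (y + 3))%N, d1.+1 => B B0.
  have := h1 B B0; rewrite time_bound_For expnS -/x -/y -/z.
  have : (0 < B ^ d1)%N by rewrite expn_gt0 B0.
  move: (B ^ d1)%N (time_bound c B) => w t w0 ht.
  have v0 : (0 < B * w)%N by rewrite muln_gt0 B0.
  rewrite !mulnDl !leq_add ?leq_pmulr //.
  have -> : (B * (y + 5 + t + z) = (y + 5 + z) * B + B * t)%N by ring.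
  have -> : (y * (B * w) + 5 * (B * w) + a1 * (B * w) + z * (B * w) =
             (y + 5 + z) * (B * w) + B * (a1 * w))%N by ring.
  by rewrite leq_add // leq_mul2l ?ht ?leq_pmulr // orbT.
Qed.

Lemma agree_tmp X s d z : agree X s -> agree [eta X with tmp d |-> z] s.
Proof. by apply: agree_below; apply: (@same_below_upd 0). Qed.

(* The jump pairs [Const (tmp 0) 1; Jpos l (tmp 0)] are unconditional. *)
Lemma goto_ok P l l' X a b s : agree X s ->
  onth P l = Some (Const (tmp 0) 1) -> onth P l.+1 = Some (Jpos l' (tmp 0)) ->
  exists2 Y, runs P (Config l X a b) (Config l' Y a b) 2 & agree Y s.
Proof.
move=> ag h0 h1; exists [eta X with tmp 0 |-> 1]; last exact: (@agree_tmp X s 0).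
apply: runs_step; rewrite {1}/step h0; apply: runs_one.
by rewrite /step h1.
Qed.

Lemma compile_ok P B c l X s : code_at P l (compile l c) -> wf_cmd c -> agree X s ->
  loops_le B c s ->
  exists2 Y,
    runs P (Config l X (sinp s) (sout s))
      (Config (l + size (compile l c)) Y (sinp (run c s)) (sout (run c s))) (time_bound c B) &
    agree Y (run c s).
Proof.
elim: c l X s => [|A e f|A e|e|c IHc d IHd|e c IHc d IHd|i N c IHc] l X s.
- by move=> _ _ ag _; exists X => //; rewrite addn0; apply: runs_refl.
- by move=> hc /and3P[wA we wf] ag _; apply: cput_ok.
- rewrite /= !code_at_cat !code_at_cons => -[he [hA [hR [hS _]]]] /andP[wA we] ag _.
  have [Y [rY vY sY]] := cexp_ok (sinp s) (sout s) he we ag.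
  have [Z [rZ vZ sZ]] := cadr_ok Y (sinp s) (sout s) hA.
  have agZ : agree Z s by apply: agree_below ag; apply: same_below_trans sY sZ.
  eexists.
    rewrite !size_cat /= !addnA addn2.
    have r := runs_trans rY (runs_trans rZ (runs_step (runs_one _))).
    by apply: runs_le (r _ _) _; [rewrite /step hR hS | lia].
  rewrite /= vZ vY; apply: agree_upd => //.
  by have := agree_tmp 1 (head 0 (sinp s)) agZ.
- rewrite /= !code_at_cat !code_at_cons => -[he [hP _]] we ag _.
  have [Y [rY vY sY]] := cexp_ok (sinp s) (sout s) he we ag.
  exists Y; last by move=> A z wA; rewrite (agree_below sY ag).
  rewrite !size_cat addnA; apply: (runs_trans rY).
  by apply: runs_step; rewrite {1}/step hP addn1 vY; apply: runs_refl.
- rewrite /= code_at_cat => -[hc hd] /andP[wc wd] ag [lc ld].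
  have [Y rY agY] := IHc _ _ _ hc wc ag lc.
  have [Z rZ agZ] := IHd _ _ _ hd wd agY ld.
  by exists Z => //; rewrite size_cat addnA; apply: runs_trans rY rZ.
- rewrite /= !code_at_cat !code_at_cons code_at_cat !code_at_cons.
  set h := cexp 0 e.
  set q := compile _ d; set l1 := (_ + 2)%N; set p := compile _ c.
  case=> hh [hJ []]; rewrite -![(l + size h).+1]addn1 => hq [hC [hJ' hp]].
  move=> /and3P[we wc wd] ag.
  have [Y [rY vY sY]] := cexp_ok (sinp s) (sout s) hh we ag.
  have agY := agree_below sY ag.
  have -> : (l + size (h ++ Jpos l1 (tmp 0) :: q ++
     [:: Const (tmp 0) 1, Jpos (l1 + size p) (tmp 0) & p]))%N = (l1 + size p)%N.
    by rewrite /l1 !size_cat /= !size_cat /=; lia.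
  case: ifP => he li.
    have [Z rZ agZ] : exists2 Z, runs P (Config l1 Y (sinp s) (sout s))
        (Config (l1 + size p) Z (sinp (run c s)) (sout (run c s))) (time_bound c B) &
        agree Z (run c s).
      by apply: IHc => //; move: hp; congr code_at; rewrite /l1; lia.
    exists Z => //; rewrite -addnA; apply: (runs_trans rY).
    apply: (@runs_le _ _ _ (time_bound c B).+1); last by lia.
    by apply: runs_step; rewrite {1}/step hJ vY he.
  have [Z rZ agZ] := IHd _ _ _ hq wd agY li.
  have [W rW agW] := goto_ok (sinp (run d s)) (sout (run d s)) agZ hC hJ'.
  exists W => //; rewrite -addnA; apply: (runs_trans rY).
  apply: (@runs_le _ _ _ (time_bound d B + 2).+1); last by lia.
  apply: runs_step; rewrite {1}/step hJ vY he -addn1.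
  exact: runs_trans rZ rW.
- rewrite compile_For time_bound_For; cbv zeta; set h0 := for_init i; set h := for_test i N.
  set top := (l + size h0)%N; set l1 := (_ + 3)%N; set p := compile _ c.
  set h1 := for_next i.
  set l2 := (l1 + size p + size h1 + 2)%N.
  have size_for (p0 p1 p2 p3 : seq instr) x y z u v :
      size (p0 ++ p1 ++ [:: x; y; z] ++ p2 ++ p3 ++ [:: u; v]) =
      (size p0 + size p1 + 3 + size p2 + size p3 + 2)%N.
    by rewrite !size_cat /=; lia.
  rewrite size_for !addnA -/top -/l1 -/l2.
  case/code_at_loop=> hh0 hh [hJ hC hJ'] [hp hh1] [hC2 hJ2].
  case/and5P=> wi wN iN wci /andP[wcN wc] ag [lN lb].
  have frame A k : ~~ writes c A -> A != i -> for_state i c s k A 0 = s A 0.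
    move=> wA /negPf Ai; elim: k => //= k IHk.
    by rewrite /for_state /= run_frame //= Ai.
  set n := nats (s N 0) in lN lb *.
  (* Induction on the number [j] of iterations left, starting at the test with [k] in the counter.
     The extra [size h + 3] pays for the final failing test. *)
  have loop j k X' : (k + j = n)%N -> agree X' (upd (for_state i c s k) i 0 k%:Z) ->
    exists2 Y,
      runs P (Config top X' (sinp (for_state i c s k)) (sout (for_state i c s k)))
        (Config l2 Y (sinp (for_state i c s n)) (sout (for_state i c s n)))
        (j * (size h + 5 + time_bound c B + size h1) + (size h + 3)) &
      agree Y (upd (for_state i c s n) i 0 n%:Z).
    elim: j k X' => [|j IHj] k X'.
      rewrite addn0 mul0n add0n => -> agX.
      have we : wf_exp (Dif (Var N) (Var i)) by rewrite /= wi wN.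
      have [Y [rY vY sY]] := cexp_ok (sinp (for_state i c s n))
        (sout (for_state i c s n)) hh we agX.
      have [Z rZ agZ] := goto_ok (sinp (for_state i c s n))
        (sout (for_state i c s n)) (agree_below sY agX) hC hJ'.
      exists Z => //; apply: (runs_trans rY); apply: runs_step.
      rewrite {1}/step hJ vY /= (eqxx i) [N == i]eq_sym (negPf iN) /=.
      rewrite frame 1?eq_sym // [0 < _](_ : _ = false); first exact: rZ.
      apply/negbTE; rewrite subr_gt0 /n; case: (s N 0) => [x|x] /=; lia.
    move=> kn agX.
    have we : wf_exp (Dif (Var N) (Var i)) by rewrite /= wi wN.
    have [Y [rY vY sY]] := cexp_ok (sinp (for_state i c s k))
      (sout (for_state i c s k)) hh we agX.
    have kn' : (k < n)%N by lia.
    have [Z rZ agZ] := IHc _ _ _ hp wc (agree_below sY agX) (lb k kn').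
    have wh1 : wf_exp (Add (Var i) (Lit 1)) by rewrite /= wi.
    have [W rW agW] := cput_ok hh1 wi isT wh1 agZ.
    have [V rV agV] := goto_ok (sinp (for_state i c s k.+1))
      (sout (for_state i c s k.+1)) agW hC2 hJ2.
    have ei : ev (Add (Var i) (Lit 1)) (for_state i c s k.+1) = k.+1%:Z.
      by rewrite /= /for_state /= run_frame //= (eqxx i) /=; lia.
    have [||U rU agU] := IHj k.+1 V; first by lia.
      by move: agV; rewrite -/(for_state i c s k.+1) -ei.
    exists U => //; have s1 : step P (Config (top + size h) Y
        (sinp (for_state i c s k)) (sout (for_state i c s k))) =
        Config l1 Y (sinp (for_state i c s k)) (sout (for_state i c s k)).
      rewrite /step hJ vY /= (eqxx i) [N == i]eq_sym (negPf iN) /= frame 1?eq_sym //.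
      rewrite [0 < _](_ : _ = true) // subr_gt0.
      by move: kn'; rewrite /n; case: (s N 0) => [x|x] /=; lia.
    have r := runs_trans rY (runs_trans (runs_one s1)
      (runs_trans rZ (runs_trans rW (runs_trans rV rU)))).
    apply: runs_le r _; rewrite -/(for_test i N) -/(for_next i) -/h -/h1.
    by rewrite mulSn; lia.
  have [Y0 rY0 agY0] := cput_ok hh0 wi isT isT ag.
  have [Y rY agY] := loop n 0 Y0 erefl agY0.
  exists Y => //; apply: runs_le (runs_trans rY0 rY) _.
  rewrite -/(for_init i) -/h0.
  by have := leq_mul lN (leqnn (size h + 5 + time_bound c B + size h1)); lia.
Qed.

(** * Loop limits and halting *)

Definition start (a : seq int) : state := State (fun _ _ => 0) a [::].

Fixpoint within (lims : pred nat) (c : cmd) : bool :=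
  match c with
  | Seq c d | If _ c d => within lims c && within lims d
  | For i N c => lims N && within lims c
  | _ => true
  end.

(** For pieces of program that never write their limits: the initial values bound every loop at any
    depth of nesting, without following the run. *)
Lemma within_loops_le (lims : pred nat) B c (s : state) : within lims c ->
  (forall N, lims N -> ~~ writes c N /\ (nats (s N 0) <= B)%N) -> loops_le B c s.
Proof.
elim: c s => //= [c IHc d IHd|e c IHc d IHd|i N c IHc] s.
- case/andP=> wc wd h; split.
    by apply: IHc => // N /h[]; rewrite negb_or => /andP[].
  apply: IHd => // N /h[]; rewrite negb_or => /andP[hc hd].
  by rewrite run_frame.
- case/andP=> wc wd h; case: ifP => _; [apply: IHc|apply: IHd] => // N /h[];
  by rewrite negb_or => /andP[].
- case/andP=> lN wc h; split; first by case: (h N lN).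
  move=> k _; apply: IHc => // M lM; have := h M lM.
  rewrite negb_or => -[/andP[/negPf Mi Mc] hB]; split=> //=.
  rewrite Mi /=; elim: k => //= k IHk.
  by rewrite /for_state /= run_frame //= Mi.
Qed.

Lemma compile_halts B c a : wf_cmd c -> loops_le B c (start a) ->
  halts_within (compile 0 c) a (time_bound c B) (sout (run c (start a))).
Proof.
move=> wc lc; pose P := compile 0 c.
have at0 : code_at P 0 (compile 0 c) by move=> k _.
have [|Y [k kn e] _] := compile_ok (X := fun=> 0) at0 wc _ lc; first by move=> A z _.
rewrite /halts_within -(subnK kn) iterD e.
(* After [k] steps the program counter is past the code, and the remaining steps change nothing. *)
elim: (_ - _)%N => [//|m IHm]; rewrite iterS /step.
case: (iter m _ _) IHm => l X u v /= [hl hv].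
by rewrite onth_default.
Qed.

Lemma halts_within_le P a m n b : halts_within P a m b -> (m <= n)%N ->
  halts_within P a n b.
Proof.
move=> [h1 h2] mn; rewrite /halts_within -(subnK mn) iterD.
have fix_step k : iter k (step P) (iter m (step P) (init a)) =
    iter m (step P) (init a).
  elim: k => //= k ->; case: (iter m _ _) h1 => l X u v /= hl.
  by rewrite onth_default.
by rewrite fix_step.
Qed.

Fixpoint reads (c : cmd) : bool :=
  match c with
  | Input _ _ => true
  | Seq c d | If _ c d => reads c || reads d
  | For _ _ c => reads c
  | _ => false
  end.

Fixpoint prints (c : cmd) : bool :=
  match c with
  | Output _ => true
  | Seq c d | If _ c d => prints c || prints d
  | For _ _ c => prints c
  | _ => false
  end.

Lemma run_sinp c s : ~~ reads c -> sinp (run c s) = sinp s.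
Proof.
elim: c s => //= [c IHc d IHd|e c IHc d IHd|i N c IHc] s.
- by case/norP=> hc hd; rewrite IHd ?IHc.
- by case/norP=> hc hd; case: ifP; rewrite ?IHc ?IHd.
- by move=> hc; elim: (nats _) => //= k IHk; rewrite IHc.
Qed.

Lemma run_sout c s : ~~ prints c -> sout (run c s) = sout s.
Proof.
elim: c s => //= [c IHc d IHd|e c IHc d IHd|i N c IHc] s.
- by case/norP=> hc hd; rewrite IHd ?IHc.
- by case/norP=> hc hd; case: ifP; rewrite ?IHc ?IHd.
- by move=> hc; elim: (nats _) => //= k IHk; rewrite IHc.
Qed.

(** * Rules for sequences, conditionals and loops *)

Lemma run_seq c d s : run (Seq c d) s = run d (run c s).
Proof. by []. Qed.

Lemma run_if e c d s : run (If e c d) s = if 0 < ev e s then run c s else run d s.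
Proof. by []. Qed.

(** The step may use that arrays not written by the body keep their values from before the loop, so
    an invariant has to mention only what changes. *)
Lemma for_inv (J : nat -> state -> Prop) i c (s : state) n :
  J 0 s ->
  (forall k t, (k < n)%N -> J k t ->
     (forall A z, ~~ writes c A -> A != i -> t A z = s A z) ->
     J k.+1 (run c (upd t i 0 k%:Z))) ->
  forall k, (k <= n)%N -> J k (for_state i c s k) /\
    forall A z, ~~ writes c A -> A != i -> for_state i c s k A z = s A z.
Proof.
move=> J0 step; elim=> // k IHk kn; have [Jk fr] := IHk (ltnW kn).
have Jk1 := step _ _ kn Jk fr; split=> // A z wA Ai.
by rewrite /for_state /= run_frame //= (negPf Ai) /=; apply: fr.
Qed.

Lemma run_for (J : nat -> state -> Prop) i N c (s : state) n :
  s N 0 = n%:Z -> J 0 s ->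
  (forall k t, (k < n)%N -> J k t ->
     (forall A z, ~~ writes c A -> A != i -> t A z = s A z) ->
     J k.+1 (run c (upd t i 0 k%:Z))) ->
  exists2 t, J n t & run (For i N c) s = upd t i 0 n%:Z.
Proof.
move=> sN J0 step; rewrite /= sN /=; exists (for_state i c s n) => //.
by case: (for_inv J0 step (leqnn n)).
Qed.

(** A limit read from the input, such as the number of items of a set, is known only along the run,
    so the loop bound and the invariant are proved together. *)
Lemma run_for_le (J : nat -> state -> Prop) i N c (s : state) n B :
  s N 0 = n%:Z -> (n <= B)%N -> J 0 s ->
  (forall k t, (k < n)%N -> J k t ->
     (forall A z, ~~ writes c A -> A != i -> t A z = s A z) ->
     loops_le B c (upd t i 0 k%:Z) /\ J k.+1 (run c (upd t i 0 k%:Z))) ->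
  loops_le B (For i N c) s /\
  exists2 t, J n t & run (For i N c) s = upd t i 0 n%:Z.
Proof.
move=> sN nB J0 step.
have step' k t kn Jk fr := (step k t kn Jk fr).2.
split; last exact: run_for sN J0 step'.
rewrite /= sN; split=> // k kn; have [Jk fr] := for_inv J0 step' (ltnW kn).
by case: (step _ _ kn Jk fr).
Qed.

(** * Primal-dual matching *)

Section PrimalDual.

Variables (E Q I : finType) (S : E -> I) (col : E -> Q) (good : pred E).
Variable c : E -> int.

Implicit Types (f X : Q -> option E) (Y : I -> Q -> option E) (u : I -> int).
Implicit Types (v : Q -> int) (W : pred I) (M : pred Q).

Definition assigned f i (q : Q) : bool := if f q is Some e then S e == i else false.

Definition load f (i : I) : nat := \sum_(q : Q) assigned f i q.

Definition valid f := forall q e, f q = Some e -> col e = q /\ good e.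

Definition dual u v :=
  (forall e, good e -> u (S e) + v (col e) <= c e) /\ (forall q, v q <= 0).

Definition tight u v f := forall q e, f q = Some e -> c e = u (S e) + v q.

(** Complementary slackness. It constrains [v] only: the demands of the sets are equalities, so [u]
    is free in sign. *)
Definition slack u v X :=
  [/\ valid X, dual u v, tight u v X & forall q, X q = None -> v q = 0].

(* Y s is the matching reached from X by moving one unit of demand of set s over
   to the root along an alternating path of tight items. *)
Definition matching_ok (root : I) X u v W M (s : I) f :=
  [/\ valid f, tight u v f, forall q, ~~ M q -> f q = X q,
      forall q, M q -> exists2 e, f q = Some e & W (S e) &
      forall i, (load f i + (i == s) = load X i + (i == root))%N].

Definition tree root X Y u v W M :=
  [/\ W root, dual u v, forall q, X q = None -> v q = 0,
      forall q, M q -> X q &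
      forall s, W s -> matching_ok root X u v W M s (Y s)].

Definition candidate W M e := [&& good e, W (S e) & ~~ M (col e)].

Definition shift_u W u d i := if W i then u i + d else u i.
Definition shift_v M v d q := if M q then v q - d else v q.

Lemma tree_init X u v root : slack u v X ->
  tree root X (fun=> X) u v (pred1 root) pred0.
Proof.
case=> vX du tX v0; split=> //=.
by move=> s /eqP ->; split.
Qed.

(** The natural subtraction is exact, since [assigned_le_load] bounds the subtrahend. *)
Lemma load_set f q e i : load [eta f with q |-> Some e] i =
  (load f i - assigned f i q + (S e == i))%N.
Proof.
rewrite /load (bigD1 q) //= [in RHS](bigD1 q) //= addKn addnC {2}/assigned /= eqxx.
by congr (_ + _)%N; apply: eq_bigr => j /negPf jq; rewrite /assigned /= jq.
Qed.

Lemma assigned_le_load f q i : (assigned f i q <= load f i)%N.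
Proof. by rewrite /load (bigD1 q) //= leq_addr. Qed.

(** Inside the tree the changes of [u] and [v] cancel; on candidates minimality of [d] keeps the
    dual feasible. From an unmarked set to a marked column the slack may grow, but no carried
    matching uses such an item, as marked columns are matched into marked sets. *)
Lemma tree_shift root X Y u v W M e d :
  tree root X Y u v W M -> candidate W M e ->
  d = c e - u (S e) - v (col e) ->
  (forall e', candidate W M e' -> d <= c e' - u (S e') - v (col e')) ->
  tree root X Y (shift_u W u d) (shift_v M v d) W M /\
  c e = shift_u W u d (S e) + shift_v M v d (col e).
Proof.
move=> [Wr [du v0] vX MX tY] /and3P[ge We Me] dE dmin.
have d0 : 0 <= d by rewrite dE; have := du e ge; lia.
split; last by rewrite /shift_u /shift_v We (negPf Me) dE; lia.
split=> //.
- split=> [e' ge'|q]; rewrite /shift_u /shift_v.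
    have := du e' ge'; case: ifP => We'; case: ifP => Me' h; try lia.
    by have := dmin e'; rewrite /candidate ge' We' Me' => /(_ isT); lia.
  by have := v0 q; case: ifP; lia.
- move=> q /[dup] Xq /vX vq; rewrite /shift_v vq; case: ifP => // /MX.
  by rewrite Xq.
- move=> s /tY[vf tf fX fM cf]; split=> // q e' fq.
  have [ce' ge'] := vf _ _ fq; have te' := tf _ _ fq.
  rewrite te' /shift_u /shift_v; case: ifP => We'; case: ifP => Me'; try lia.
    (* The item is itself a tight candidate here, so minimality gives [d <= 0], hence [d = 0]. *)
    have := dmin e'; rewrite /candidate ge' We' ce' Me' => /(_ isT).
    by rewrite te'; lia.
  by have [e2] := fM _ Me'; rewrite fq => -[<-]; rewrite We'.
Qed.

(** The set [S e] takes over column [q], which releases one unit of [S e']: the result is the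
    matching to be carried by [S e']. If that set is marked already, only the column is new. Taking
    [W'] and [Y'] up to pointwise equality lets one statement cover both cases. *)
Lemma tree_mark root X Y u v W M e q e' :
  tree root X Y u v W M -> candidate W M e -> c e = u (S e) + v (col e) ->
  q = col e -> X q = Some e' ->
  forall W' Y', W' =1 (fun i => (i == S e') || W i) ->
  (forall i, W i -> Y' i =1 Y i) ->
  (~~ W (S e') -> Y' (S e') =1 [eta Y (S e) with q |-> Some e]) ->
  tree root X Y' u v W' (fun q' => (q' == q) || M q').
Proof.
move=> [Wr du vX MX tY] /and3P[ge We Me] te qE Xq W' Y' W'E Y'W Y'S.
have load_ext f g i : f =1 g -> load f i = load g i.
  by move=> fg; apply: eq_bigr => j _; rewrite /assigned fg.
split=> //; first by rewrite W'E Wr orbT.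
  by move=> q' /orP[/eqP->|/MX//]; rewrite Xq.
have [vY tiY YX YM cY] := tY _ We.
have Yq : Y (S e) q = Some e' by rewrite YX // qE.
move=> s; rewrite W'E; have [Ws _|Ws] := boolP (W s).
  have [vf tf fX fM cf] := tY _ Ws; split.
  - by move=> q' e2; rewrite Y'W //; apply: vf.
  - by move=> q' e2; rewrite Y'W //; apply: tf.
  - by move=> q'; rewrite negb_or Y'W // => /andP[_]; apply: fX.
  - move=> q' /orP[/eqP->|/fM[e2 h1 h2]]; last first.
      by exists e2; rewrite ?Y'W // W'E h2 orbT.
    by exists e'; rewrite ?W'E ?eqxx // Y'W // fX ?qE // -qE.
  - by move=> i; rewrite (load_ext _ (Y s)) //; apply: Y'W.
rewrite orbF => /eqP sE; rewrite sE in Ws *; have {}Y'S := Y'S Ws; split.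
- move=> q' e2; rewrite Y'S /=; case: eqP => [-> [<-]|_]; first by rewrite qE.
  exact: vY.
- move=> q' e2; rewrite Y'S /=; case: eqP => [-> [<-]|_]; first by rewrite qE.
  exact: tiY.
- move=> q'; rewrite negb_or Y'S /= => /andP[/negPf-> /YX]//.
- move=> q' /orP[/eqP->|Mq']; rewrite Y'S /=.
    by exists e; rewrite ?eqxx // W'E We orbT.
  case: eqP => [|_]; first by move=> qq; rewrite -qE -qq Mq' in Me.
  by have [e2 h1 h2] := YM _ Mq'; exists e2 => //; rewrite W'E h2 orbT.
- move=> i; rewrite (load_ext _ _ i Y'S) load_set.
  have := cY i; have := assigned_le_load (Y (S e)) q i.
  rewrite /assigned Yq [S e' == i]eq_sym [S e == i]eq_sym; lia.
Qed.

(** The matching [Y (S e)] has given up one unit of [S e] for one of the root, and [e] restores that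
    unit on a free column. Columns still free were free in [X], since marked columns stay matched,
    so [v] vanishes on them. *)
Lemma tree_done root X Y u v W M e q X' :
  tree root X Y u v W M -> candidate W M e -> c e = u (S e) + v (col e) ->
  q = col e -> X q = None -> X' =1 [eta Y (S e) with q |-> Some e] ->
  slack u v X' /\ forall i, load X' i = (load X i + (i == root))%N.
Proof.
move=> [Wr du vX MX tY] /and3P[ge We Me] te qE Xq X'E.
have [vY tiY YX YM cY] := tY _ We.
split; first split=> //.
- move=> q' e2; rewrite X'E /=; case: eqP => [-> [<-]|_]; first by rewrite qE.
  exact: vY.
- move=> q' e2; rewrite X'E /=; case: eqP => [-> [<-]|_]; first by rewrite qE.
  exact: tiY.
- move=> q'; rewrite X'E /=; case: eqP => [//|_] Yq'; apply: vX.
  by rewrite -YX //; apply/negP => /YM[e2]; rewrite Yq'.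
- move=> i; rewrite -cY.
  transitivity (load [eta Y (S e) with q |-> Some e] i).
    by apply: eq_bigr => j _; rewrite /assigned X'E.
  rewrite load_set /assigned YX ?qE // -qE Xq subn0 eq_sym //.
Qed.

(** * Certificates of infeasibility and optimality *)

Definition picks (p : I -> nat) (y : pred E) :=
  [/\ forall i, (\sum_(e | S e == i) y e = p i)%N, forall e, y e -> good e &
      forall e e', y e -> y e' -> col e = col e' -> e = e'].

Lemma load_sum W f : (\sum_(i | W i) load f i =
  \sum_(q : Q) (if f q is Some e then W (S e) else false))%N.
Proof.
rewrite exchange_big /=; apply: eq_bigr => q _; rewrite /assigned.
case: (f q) => [e|]; last by rewrite big1.
have [We|We] := boolP (W (S e)).
  rewrite (bigD1 (S e)) //= eqxx big1 // => i /andP[_ /negPf iS].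
  by rewrite eq_sym iS.
by rewrite big1 // => i Wi; case: eqP => // ei; rewrite ei Wi in We.
Qed.

Lemma picks_sum p y W : picks p y ->
  (\sum_(i | W i) p i = #|[pred e | y e && W (S e)]|)%N.
Proof.
case=> py _ _; rewrite -sum1_card.
under eq_bigr do rewrite -py.
rewrite [RHS](partition_big S W) /=; last by move=> e /andP[].
apply: eq_bigr => i Wi; rewrite big_mkcond [RHS]big_mkcond; apply: eq_bigr => e _.
by rewrite inE; case: eqP => [->|]; rewrite ?Wi ?andbT ?andbF //; case: (y e).
Qed.

(* Hall: the marked columns are matched into the marked sets, whose total demand
   they fall short of. *)
Lemma tree_stuck root X Y u v W M p y :
  tree root X Y u v W M -> (forall e, ~~ candidate W M e) ->
  (forall i, (load X i <= p i)%N) -> (load X root < p root)%N -> ~ picks p y.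
Proof.
move=> [Wr du vX MX tY] noc Xp Xr py.
have [vY tiY YX YM cY] := tY _ Wr.
have := picks_sum W py; have [_ gy iy] := py.
(* Without candidates, the items that [y] takes from marked sets lie in marked columns, at most one
   in each. *)
have h1 : (#|[pred e | y e && W (S e)]| <= #|M|)%N.
  rewrite -(card_in_imset (f := col)); last first.
    by move=> e e' /andP[ye _] /andP[ye' _]; apply: iy.
  apply: subset_leq_card; apply/subsetP => _ /imsetP[e /andP[ye We] ->].
  by have := noc e; rewrite /candidate gy //= We /= negbK.
have h2 : (#|M| <= \sum_(i | W i) load (Y root) i)%N.
  rewrite load_sum -sum1_card big_mkcond /=; apply: leq_sum => q _.
  by rewrite unfold_in; case: ifP => // /YM[e -> ->].
have h3 : (\sum_(i | W i) load (Y root) i < \sum_(i | W i) p i)%N.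
  (* For the root the exchange of demand is trivial. *)
  have e i : load (Y root) i = load X i by have := cY i; lia.
  under eq_bigr do rewrite e.
  rewrite (bigD1 root) //= [ltnRHS](bigD1 root) //= -addSn leq_add //.
  exact: leq_sum.
lia.
Qed.

Definition chosen X e : bool := X (col e) == Some e.

Lemma chosen_picks X p : valid X -> (forall i, load X i = p i) ->
  picks p (chosen X).
Proof.
move=> vX pX; split.
- move=> i; rewrite -pX (partition_big col predT) //=; apply: eq_bigr => q _.
  rewrite /assigned /chosen; case Xq : (X q) => [e0|]; last first.
    by rewrite big1 // => e /andP[_ /eqP->]; rewrite Xq.
  have [ce0 _] := vX _ _ Xq; rewrite big_mkcond (bigD1 e0) //= ce0 Xq !eqxx andbT.
  rewrite big1 ?addn0 => [|e ne]; first by case: eqP.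
  case: ifP => // /andP[_ /eqP->]; rewrite Xq; case: eqP => // -[ee].
  by rewrite ee eqxx in ne.
- by move=> e /eqP /vX[].
- by move=> e e' /eqP h1 /eqP h2 ce; rewrite ce h2 in h1; case: h1.
Qed.

Lemma picks_u_sum p y u : picks p y ->
  \sum_(e : E) u (S e) * (y e)%:Z = \sum_(i : I) u i * (p i)%:Z.
Proof.
case=> py _ _; rewrite (partition_big S predT) //=; apply: eq_bigr => i _.
rewrite -py (big_morph Posz PoszD (erefl (Posz 0))) big_distrr /=.
by apply: eq_bigr => e /eqP->.
Qed.

Lemma picks_col p y q : picks p y -> (\sum_(e | col e == q) y e <= 1)%N.
Proof.
case=> _ _ iy; rewrite -big_mkcondr /= sum1_card; apply/card_le1_eqP => e e'.
by rewrite !unfold_in => /andP[/eqP h1 ye] /andP[/eqP h2 ye']; apply: iy; rewrite // h1.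
Qed.

Lemma v_sum y v : \sum_(e : E) v (col e) * (y e)%:Z =
  \sum_(q : Q) v q * (\sum_(e | col e == q) y e)%N%:Z.
Proof.
rewrite (partition_big col predT) //=; apply: eq_bigr => q _.
by rewrite (big_morph Posz PoszD (erefl (Posz 0))) big_distrr /=; apply: eq_bigr => e /eqP->.
Qed.

(** Weak duality: the cost of [y] is at least the sum of its potentials, and for [X] there is
    equality. The [u] parts agree because both meet the demands [p], which leaves the [v] parts,
    compared column by column. *)
Lemma slack_optimal X u v p y : slack u v X -> (forall i, load X i = p i) ->
  picks p y ->
  \sum_(e : E) c e * (chosen X e)%:Z <= \sum_(e : E) c e * (y e)%:Z.
Proof.
case=> vX [du v0] tX vN pX py; have pc := chosen_picks vX pX.
apply: (@le_trans _ _ (\sum_(e : E) (u (S e) + v (col e)) * (y e)%:Z)).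
  have -> : \sum_(e : E) c e * (chosen X e)%:Z =
      \sum_(e : E) (u (S e) + v (col e)) * (chosen X e)%:Z.
    apply: eq_bigr => e _; rewrite /chosen; case: eqP => [/[dup] Xe /tX ->|] //.
    by rewrite !mulr0.
  under eq_bigr do rewrite mulrDl; under [leRHS]eq_bigr do rewrite mulrDl.
  rewrite !big_split /= (picks_u_sum _ pc) (picks_u_sum _ py) lerD2l !v_sum.
  (* A column used by [X] counts 1 for [X] and at most 1 for [y], with [v q <= 0]; on a free column
     [v q = 0]. *)
  apply: ler_sum => q _; case Xq : (X q) => [e|]; last by rewrite vN ?mul0r.
  apply: ler_wnM2l; rewrite // lez_nat (leq_trans (picks_col q py)) //.
  have [ce _] := vX _ _ Xq.
  by rewrite (bigD1 e) ?ce //= /chosen ce Xq eqxx.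
apply: ler_sum => e _; have [_ gy _] := py.
by case ye : (y e); rewrite ?mulr0 // !mulr1 du // gy.
Qed.

End PrimalDual.

(** * The program *)

(* A clique is named by the least index of its members (aREP), and this is also
   the index of its column.  A matching stores in each column 1 + the index of
   the chosen item, or 0: aX is the current matching, and the one carried by the
   marked set i occupies aY from position aROW[i] on.  aMS and aMC mark sets and
   columns, aU and aV are the potentials, aBEST is 1 + the index of the best
   candidate found so far, or 0, and aBD its reduced cost. *)
Notation aN := 1%N.
Notation aM := 2%N.
Notation aR := 3%N.
Notation aI := 4%N.
Notation aJ := 5%N.
Notation aOFF := 6%N.
Notation aP := 7%N.
Notation aS := 8%N.
Notation aC := 9%N.
Notation aU := 10%N.
Notation aV := 11%N.
Notation aREP := 12%N.
Notation aBAD := 13%N.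
Notation aT := 14%N.
Notation aA := 15%N.
Notation aB := 16%N.
Notation aE := 17%N.
Notation aF := 18%N.
Notation aX := 19%N.
Notation aY := 20%N.
Notation aROW := 21%N.
Notation aMS := 22%N.
Notation aMC := 23%N.
Notation aBEST := 24%N.
Notation aBD := 25%N.
Notation aDONE := 26%N.
Notation aFAIL := 27%N.
Notation aK1 := 28%N.
Notation aK2 := 29%N.
Notation aK3 := 30%N.
Notation aD := 31%N.
Notation aQ := 32%N.
Notation aG := 33%N.
Notation aH := 34%N.

Declare Scope cmd_scope.
Delimit Scope cmd_scope with cmd.
Bind Scope cmd_scope with cmd.
Local Notation "c ;; d" := (Seq c d)
  (at level 60, right associativity, format "c ;;  '//' d") : cmd_scope.
Definition Set0 A e := Put A (Lit 0) e.
Arguments Set0 A e /.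
Definition When e c := If e c Skip.
Arguments When e c /.
Definition Unless e c := If e Skip c.
Arguments Unless e c /.

Local Open Scope cmd_scope.

(* aU[i] becomes the minimum of 0 and the costs of set i, so that u together with
   v = 0 is dual feasible. *)
Definition read_item : cmd :=
  Input aC (Var aN) ;;
  Put aS (Var aN) (Var aI) ;;
  Put aREP (Var aN) (Var aN) ;;
  When (Dif (Get aU (Var aI)) (Get aC (Var aN)))
    (Put aU (Var aI) (Get aC (Var aN))) ;;
  Set0 aN (Add (Var aN) (Lit 1)).

(** Items are numbered consecutively across the sets; [aOFF] keeps the first number of each set,
    which later turns a pair of set and item into one index. *)
Definition read_set : cmd :=
  Input aR (Lit 0) ;;
  Input aP (Var aI) ;;
  Put aOFF (Var aI) (Var aN) ;;
  For aJ aR read_item.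

Definition read_sets : cmd := Input aM (Lit 0) ;; For aI aM read_set.

Definition read_index (A : nat) : cmd :=
  Input aA (Lit 0) ;;
  Input aB (Lit 0) ;;
  Set0 A (Add (Get aOFF (Var aA)) (Var aB)).

Definition link (A B : nat) : cmd :=
  When (Dif (Get aREP (Var A)) (Var B)) (Put aREP (Var A) (Var B)).

(** Only signs can be tested, so equality of the two indices is the failure of both strict
    comparisons. *)
Definition ban_self : cmd :=
  Unless (Dif (Var aE) (Var aF))
    (Unless (Dif (Var aF) (Var aE)) (Put aBAD (Var aE) (Lit 1))).

(* By transitivity the clique of an item consists of its neighbours and itself, so
   one pass of minima over the tuples finds its least member. *)
Definition read_tuple : cmd :=
  read_index aE ;;
  read_index aF ;;
  ban_self ;;
  link aE aF ;;
  link aF aE.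

Definition read_tuples : cmd := Input aT (Lit 0) ;; For aI aT read_tuple.

(** Row [i] starts at [i] times the number of items, obtained by repeated addition. Iteration [i]
    writes entry [i + 1]; entry 0 is 0 from the start. *)
Definition rows : cmd :=
  For aI aM
    (Put aROW (Add (Var aI) (Lit 1)) (Add (Get aROW (Var aI)) (Var aN))).

(** * The primal-dual search *)

Definition keep : cmd :=
  Set0 aBEST (Add (Var aK3) (Lit 1)) ;;
  Set0 aBD (Var aD).

Definition scan : cmd :=
  When (Get aMS (Get aS (Var aK3)))
    (When (Dif (Lit 1) (Get aMC (Get aREP (Var aK3))))
      (When (Dif (Lit 1) (Get aBAD (Var aK3)))
        (Set0 aD (Dif (Dif (Get aC (Var aK3)) (Get aU (Get aS (Var aK3))))
                      (Get aV (Get aREP (Var aK3)))) ;;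
         If (Var aBEST) (When (Dif (Var aBD) (Var aD)) keep) keep))).

Definition copy_row : cmd :=
  For aK3 aN
    (Put aY (Add (Get aROW (Var aH)) (Var aK3))
       (Get aY (Add (Get aROW (Var aG)) (Var aK3)))).

Definition extend : cmd :=
  Set0 aH (Get aS (Dif (Get aX (Var aQ)) (Lit 1))) ;;
  Unless (Get aMS (Var aH))
    (Put aMS (Var aH) (Lit 1) ;;
     copy_row ;;
     Put aY (Add (Get aROW (Var aH)) (Var aQ)) (Var aBEST)).

Definition adopt_row : cmd :=
  For aK3 aN
    (Put aX (Var aK3) (Get aY (Add (Get aROW (Var aG)) (Var aK3)))).

Definition augment : cmd :=
  Set0 aDONE (Lit 1) ;;
  adopt_row ;;
  Put aX (Var aQ) (Var aBEST).

Definition locate : cmd :=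
  Set0 aE (Dif (Var aBEST) (Lit 1)) ;;
  Set0 aG (Get aS (Var aE)) ;;
  Set0 aQ (Get aREP (Var aE)).

Definition raise_u : cmd :=
  For aK3 aM
    (When (Get aMS (Var aK3))
       (Put aU (Var aK3) (Add (Get aU (Var aK3)) (Var aBD)))).

Definition lower_v : cmd :=
  For aK3 aN
    (When (Get aMC (Var aK3))
       (Put aV (Var aK3) (Dif (Get aV (Var aK3)) (Var aBD)))).

Definition advance : cmd :=
  locate ;;
  raise_u ;;
  lower_v ;;
  Put aMC (Var aQ) (Lit 1) ;;
  If (Get aX (Var aQ)) extend augment.

Definition search : cmd := Set0 aBEST (Lit 0) ;; For aK3 aN scan.

(** A bounded loop has no early exit, so after an augmentation the remaining rounds are idle. *)
Definition grow : cmd :=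
  Unless (Var aDONE) (search ;; When (Var aBEST) advance).

Definition clear_sets : cmd := For aK3 aM (Put aMS (Var aK3) (Lit 0)).

(** The same loop copies the current matching into the row of the root [aI], the only row of the
    initial tree. *)
Definition clear_cols : cmd :=
  For aK3 aN
    (Put aMC (Var aK3) (Lit 0) ;;
     Put aY (Add (Get aROW (Var aI)) (Var aK3)) (Get aX (Var aK3))).

Definition plant : cmd :=
  clear_sets ;;
  clear_cols ;;
  Put aMS (Var aI) (Lit 1) ;;
  Set0 aDONE (Lit 0).

(** A round that finds a candidate either augments or marks one more of the [aN] columns, so [aN]
    rounds without success mean that the tree is stuck. *)
Definition phase : cmd :=
  plant ;;
  For aK2 aN grow ;;
  Unless (Var aDONE) (Set0 aFAIL (Lit 1)).

(** One unit of demand per iteration. As [aN] exceeds every demand, surplus iterations are idle;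
    this keeps [aN] and [aM] the only limits in the solver. *)
Definition serve : cmd :=
  When (Dif (Get aP (Var aI)) (Var aK1)) (Unless (Var aFAIL) phase).

Definition solve : cmd := For aI aM (For aK1 aN serve).

(** A column stores 1 plus an index, so equality with [aK3 + 1] is tested as lying strictly between
    [aK3] and [aK3 + 2]. *)
Definition print_item : cmd :=
  If (Dif (Get aX (Get aREP (Var aK3))) (Var aK3))
    (If (Dif (Add (Var aK3) (Lit 2)) (Get aX (Get aREP (Var aK3))))
       (Output (Lit 1)) (Output (Lit 0)))
    (Output (Lit 0)).

Definition print_answer : cmd :=
  If (Var aFAIL) (Output (Lit 0)) (Output (Lit 1) ;; For aK3 aN print_item).

Definition ris_cmd : cmd :=
  read_sets ;; read_tuples ;; rows ;; solve ;; print_answer.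

Lemma ris_cmd_wf : wf_cmd ris_cmd.
Proof. by []. Qed.

Close Scope cmd_scope.

(** * Reading the instance *)

Lemma enum_split n (i : 'I_n) :
  enum 'I_n = take i (enum 'I_n) ++ i :: drop i.+1 (enum 'I_n).
Proof.
have {2}-> : i = nth i (enum 'I_n) i by rewrite nth_ord_enum.
by rewrite -drop_nth ?cat_take_drop // size_enum_ord.
Qed.

Section Instance.

Variable I : ris.

Definition mk (i : 'I_(nsets I)) (j : 'I_(nitems i)) : item I :=
  Tagged (fun i => 'I_(nitems i)) j.

Definition its (i : 'I_(nsets I)) : seq (item I) :=
  [seq mk j | j <- enum 'I_(nitems i)].

(** The order in which the items stand in the input; the program names an item by its position
    here. *)
Definition items : seq (item I) := flatten [seq its i | i <- enum 'I_(nsets I)].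

Definition idx (a : item I) : nat := index a items.

Definition cst (a : item I) : int := cost (tagged a).

Lemma mem_items a : a \in items.
Proof.
apply/flattenP; exists (its (tag a)); first by apply: map_f; rewrite mem_enum.
by case: a => i j; apply/mapP; exists j; rewrite ?mem_enum.
Qed.

Lemma items_uniq : uniq items.
Proof.
rewrite /items /its; apply: allpairs_uniq_dep.
- exact: enum_uniq.
- by move=> i _; apply: enum_uniq.
- by move=> [i j] [i' j'] _ _.
Qed.

Lemma idx_lt a : (idx a < size items)%N.
Proof. by rewrite index_mem mem_items. Qed.

Lemma idx_inj : injective idx.
Proof. by move=> a b /(congr1 (nth a items)); rewrite !nth_index ?mem_items. Qed.

Lemma idx_surj e : (e < size items)%N -> exists a, idx a = e.
Proof.
case E : items => [|a0 l] // he; exists (nth a0 items e).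
by rewrite /idx index_uniq ?items_uniq // E.
Qed.

Lemma idx_split l a r : items = l ++ a :: r -> idx a = size l.
Proof.
move=> e; have := items_uniq; rewrite /idx e cat_uniq /= => /and3P[_ h _].
by case/norP: h => /negPf al _; rewrite index_cat al /= eqxx addn0.
Qed.

Definition off (i : nat) : nat :=
  size (flatten [seq its i | i <- take i (enum 'I_(nsets I))]).

Lemma idx_off a : idx a = (off (tag a) + tagged a)%N.
Proof.
case: a => i j; set l := flatten [seq its i | i <- take i (enum 'I_(nsets I))].
have e : items = (l ++ [seq mk j | j <- take j (enum 'I_(nitems i))]) ++
    mk j ::
    ([seq mk j | j <- drop j.+1 (enum 'I_(nitems i))] ++
     flatten [seq its i | i <- drop i.+1 (enum 'I_(nsets I))]).
  rewrite /items {1}(enum_split i) map_cat flatten_cat /= -catA; congr cat.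
  by rewrite {1}/its {1}(enum_split j) map_cat -catA.
rewrite (idx_split e) size_cat size_map size_take size_enum_ord.
by rewrite (ltn_ord j).
Qed.

Definition enc_set (i : 'I_(nsets I)) : seq int :=
  [:: (nitems i)%:Z, (npick i)%:Z & [seq cost j | j <- enum 'I_(nitems i)]].

(** [l] lists the items read so far. The bound on [aU] is what makes the initial potentials feasible
    together with [v = 0]. *)
Definition prefix_ok (l : seq (item I)) (s : state) : Prop :=
  s aN 0 = (size l)%:Z /\
  forall a, a \in l ->
    [/\ s aS (idx a) = (tag a : nat)%:Z, s aC (idx a) = cst a,
        s aREP (idx a) = (idx a)%:Z & s aU (tag a : nat) <= cst a].

Lemma read_item_ok l a r s inp : items = l ++ a :: r -> prefix_ok l s ->
  sinp s = cst a :: inp -> s aI 0 = (tag a : nat)%:Z ->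
  prefix_ok (rcons l a) (run read_item s) /\ sinp (run read_item s) = inp.
Proof.
move=> il [sN sl] si sI; have ia := idx_split il.
have nal b : b \in l -> (idx b == idx a) = false.
  move=> bl; apply/negbTE/eqP => /idx_inj e; have := items_uniq.
  by rewrite il cat_uniq /= -e bl /= andbF.
rewrite /= si sN sI !eqxx /= subr_gt0 -ia /prefix_ok size_rcons -ia.
case: ifP => h; (split; last by []).
- split=> [|b] /=; first by rewrite sN -ia; lia.
  rewrite mem_rcons inE; have [-> _|_ /= bl] := eqVneq b a.
    by rewrite !eqxx lexx.
  have [h1 h2 h3 h4] := sl b bl; rewrite !eqz_nat nal //.
  split=> //; case: ifP => // /eqP tt; rewrite (le_trans _ h4) // tt.
  exact: ltW.
- split=> [|b] /=; first by rewrite sN -ia; lia.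
  rewrite mem_rcons inE; have [-> _|_ /= bl] := eqVneq b a.
    by rewrite !eqxx; split=> //; rewrite leNgt h.
  by have [h1 h2 h3 h4] := sl b bl; rewrite !eqz_nat nal.
Qed.

Lemma read_set_ok (i : 'I_(nsets I)) s inp B :
  prefix_ok (flatten [seq its i | i <- take i (enum 'I_(nsets I))]) s ->
  sinp s = enc_set i ++ inp -> s aI 0 = (i : nat)%:Z -> (nitems i <= B)%N ->
  let t := run read_set s in
  [/\ loops_le B read_set s,
      prefix_ok (flatten [seq its i | i <- take i.+1 (enum 'I_(nsets I))]) t,
      sinp t = inp, t aP (i : nat)%:Z = (npick i)%:Z &
      t aOFF (i : nat)%:Z = (off i)%:Z /\
      forall z, z != (i : nat)%:Z -> t aP z = s aP z /\ t aOFF z = s aOFF z].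
Proof.
set l := flatten _ => -[sN sl] si sI nB.
set s' := run (Put aOFF (Var aI) (Var aN)) (run (Input aP (Var aI))
  (run (Input aR (Lit 0)) s)).
pose J j (t : state) :=
  prefix_ok (l ++ [seq mk j | j <- take j (enum 'I_(nitems i))]) t /\
  sinp t = [seq cost j | j <- drop j (enum 'I_(nitems i))] ++ inp.
have [||k t kr [Jp Ji] fr|lim [t [Jt1 Jt2] tE]] :=
  @run_for_le J aJ aR read_item s' (nitems i) B _ nB.
- by rewrite /= si.
- by rewrite /J take0 drop0 cats0 /= si.
- split; first exact: (@within_loops_le pred0).
  pose a := mk (Ordinal kr).
  have e : items = (l ++ [seq mk j | j <- take k (enum 'I_(nitems i))]) ++
    a :: ([seq mk j | j <- drop k.+1 (enum 'I_(nitems i))] ++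
     flatten [seq its i | i <- drop i.+1 (enum 'I_(nsets I))]).
    rewrite /items {1}(enum_split i) map_cat flatten_cat /= -catA; congr cat.
    by rewrite {1}/its {1}(enum_split (Ordinal kr)) map_cat -catA.
  have [|||h1 h2] := @read_item_ok _ _ _ (upd t aJ 0 k)
    ([seq cost j | j <- drop k.+1 (enum 'I_(nitems i))] ++ inp) e.
  + by [].
  + rewrite /= Ji [drop k _](drop_nth (Ordinal kr)) ?size_enum_ord //.
    by rewrite (nth_ord_enum _ (Ordinal kr)).
  + by rewrite /= fr //= sI.
  split=> //; move: h1; congr prefix_ok.
  rewrite (take_nth (Ordinal kr)) ?size_enum_ord // map_rcons rcons_cat.
  by rewrite (nth_ord_enum _ (Ordinal kr)).
have sE : run read_set s = run (For aJ aR read_item) s' by [].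
split=> //; last 2 first.
- by rewrite sE run_frame //= sI eqxx si.
- split; first by rewrite sE run_frame //= sI eqxx sN.
  by move=> z /negPf zi; rewrite sE; split; rewrite run_frame //= sI zi.
- rewrite sE tE (take_nth i) ?size_enum_ord // map_rcons -cats1 flatten_cat /= cats0.
  by rewrite nth_ord_enum -/l; move: Jt1; rewrite take_oversize ?size_enum_ord.
- by rewrite sE tE; move: Jt2; rewrite drop_oversize ?size_enum_ord.
Qed.

Lemma read_sets_ok rest B : (nsets I <= B)%N ->
  (forall i : 'I_(nsets I), (nitems i <= B)%N) ->
  let s := start ((nsets I)%:Z ::
    flatten [seq enc_set i | i <- enum 'I_(nsets I)] ++ rest) in
  let t := run read_sets s in
  [/\ loops_le B read_sets s, prefix_ok items t, sinp t = rest,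
      t aM 0 = (nsets I)%:Z &
      forall i : 'I_(nsets I), t aP (i : nat)%:Z = (npick i)%:Z /\
                               t aOFF (i : nat)%:Z = (off i)%:Z].
Proof.
move=> mB nB s; set s' := run (Input aM (Lit 0)) s.
pose J k (t : state) :=
  [/\ prefix_ok (flatten [seq its i | i <- take k (enum 'I_(nsets I))]) t,
      sinp t = flatten [seq enc_set i | i <- drop k (enum 'I_(nsets I))] ++ rest &
      forall i : 'I_(nsets I), (i < k)%N -> t aP (i : nat)%:Z = (npick i)%:Z /\
                               t aOFF (i : nat)%:Z = (off i)%:Z].
have [||k t kr [Jp Ji JP] fr|lim [t [Jp Ji JP] tE]] :=
  @run_for_le J aI aM read_set s' (nsets I) B _ mB.
- by [].
- by rewrite /J take0 drop0; split.
- have [||||l1 l2 l3 l4 l5] := @read_set_ok (Ordinal kr) (upd t aI 0 k)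
    (flatten [seq enc_set i | i <- drop k.+1 (enum 'I_(nsets I))] ++ rest) B.
  + exact: Jp.
  + rewrite /= Ji [drop k _](drop_nth (Ordinal kr)) ?size_enum_ord //.
    by rewrite (nth_ord_enum _ (Ordinal kr)) /= -catA.
  + by [].
  + exact: nB.
  case: l5 => l5 l6; split=> //; split=> // i.
  rewrite ltnS leq_eqVlt => /orP[/eqP ik|ik].
    by have -> : i = Ordinal kr by apply: val_inj.
  have [h1 h2] := JP i ik; have [|-> ->] := l6 i; first by rewrite eqz_nat /= ltn_eqF.
  by rewrite /= h1 h2.
have sE : run read_sets s = run (For aI aM read_set) s' by [].
split.
- by split.
- by move: Jp; rewrite sE tE take_oversize ?size_enum_ord.
- by rewrite sE tE /= Ji drop_oversize ?size_enum_ord.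
- by rewrite sE run_frame.
- by move=> i; rewrite sE tE; apply: JP.
Qed.

(** * Reading the tuples *)

Definition linked (l : seq (item I * item I)) (a b : item I) : bool :=
  ((a, b) \in l) || ((b, a) \in l).

Definition is_min (A : pred (item I)) (b : item I) : Prop :=
  A b /\ forall b', A b' -> (idx b <= idx b')%N.

Definition reps_ok (A : item I -> pred (item I)) (s : state) : Prop :=
  forall a, exists2 b, s aREP (idx a) = (idx b)%:Z & is_min (A a) b.

Lemma reps_ext A A' s : (forall a, A a =1 A' a) -> reps_ok A s -> reps_ok A' s.
Proof.
move=> AA h a; have [b e [Ab mb]] := h a; exists b => //.
by split=> [|b']; rewrite -AA //; apply: mb.
Qed.

(** Only the neighbourhood of [x] gains an element, so each tuple takes a second call with the roles
    exchanged. *)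
Lemma link_ok (vA vB : nat) x y A (s : state) :
  s vA 0 = (idx x)%:Z -> s vB 0 = (idx y)%:Z -> reps_ok A s ->
  reps_ok (fun a b => A a b || (a == x) && (b == y)) (run (link vA vB) s).
Proof.
move=> sA sB h; rewrite /= sA sB subr_gt0 => a.
have [b e [Ab mb]] := h a; have [ax|ax] := eqVneq a x; last first.
  have ie : (idx a == idx x) = false by apply/eqP => /idx_inj /eqP; apply/negP.
  exists b; last by split=> [|b' /orP[/mb|//]]; rewrite ?Ab.
  by case: ifP => //= _; rewrite eqz_nat ie.
rewrite -ax e ltz_nat; case: ltnP => yb /=.
  exists y; first by rewrite eqxx.
  split=> [|b' /orP[/mb|/eqP->//]]; first by rewrite eqxx orbT.
  exact/leq_trans/ltnW.
by exists b => //; split=> [|b' /orP[/mb|/eqP->//]]; rewrite ?Ab.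
Qed.

(** The closed neighbourhood of [a] in the graph of the tuples of [l]; for all tuples and a
    transitive relation it is the clique of [a]. *)
Definition near l a b := (b == a) || linked l a b.

Definition tuples_ok l (s : state) : Prop :=
  reps_ok (near l) s /\
  forall a, s aBAD (idx a) = ((a, a) \in l : nat)%:Z.

Definition enc_tuple (t : item I * item I) : seq int := enc_item t.1 ++ enc_item t.2.

Lemma read_index_ok A x inp (s : state) : (forall i : 'I_(nsets I), s aOFF (i : nat)%:Z = (off i)%:Z) ->
  sinp s = enc_item x ++ inp -> let t := run (read_index A) s in
  t A 0 = (idx x)%:Z /\ sinp t = inp.
Proof.
by move=> so si; rewrite /= si /= !eqxx /= so idx_off PoszD.
Qed.

Lemma run_tuple s : run read_tuple s = run (link aF aE) (run (link aE aF)
  (run ban_self (run (read_index aF) (run (read_index aE) s)))).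
Proof.
rewrite /read_tuple (run_seq (read_index aE)) (run_seq (read_index aF)).
by rewrite (run_seq ban_self) (run_seq (link aE aF)).
Qed.

Lemma read_tuple_ok l x y inp (s : state) :
  (forall i : 'I_(nsets I), s aOFF (i : nat)%:Z = (off i)%:Z) ->
  sinp s = enc_tuple (x, y) ++ inp -> tuples_ok l s ->
  tuples_ok (rcons l (x, y)) (run read_tuple s) /\
  sinp (run read_tuple s) = inp.
Proof.
rewrite /enc_tuple -catA => so si [hr hb].
set s1 := run (read_index aE) s; set s2 := run (read_index aF) s1.
have [s1E s1i] := read_index_ok aE so si.
have so1 (i : 'I_(nsets I)) : s1 aOFF (i : nat)%:Z = (off i)%:Z.
  by rewrite run_frame.
have [s2F s2i] : s2 aF 0 = (idx y)%:Z /\ sinp s2 = inp.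
  exact: (read_index_ok aF so1 s1i).
have s2E : s2 aE 0 = (idx x)%:Z by rewrite run_frame.
have s2b a : s2 aBAD (idx a) = ((a, a) \in l : nat)%:Z by rewrite !run_frame.
have s2R : reps_ok (near l) s2.
  by move=> a; have [b e mb] := hr a; exists b; rewrite // !run_frame.
rewrite run_tuple -/s1 -/s2.
clearbody s2; set s3 := run ban_self s2.
have s3E : s3 aE 0 = (idx x)%:Z by rewrite run_frame.
have s3F : s3 aF 0 = (idx y)%:Z by rewrite run_frame.
have s3R : reps_ok (near l) s3.
  by move=> a; have [b e mb] := s2R a; exists b; rewrite // run_frame.
have s3b a : s3 aBAD (idx a) = ((a, a) \in rcons l (x, y) : nat)%:Z.
  rewrite /s3 /= s2E s2F !subr_gt0 !ltz_nat mem_rcons inE xpair_eqE.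
  case: ltngtP => [h|h|/idx_inj yx] /=; rewrite s2b.
  - have [->|_] //= := eqVneq a x; have [yx|//] := eqVneq x y.
    by rewrite yx ltnn in h.
  - have [->|_] //= := eqVneq a x; have [yx|//] := eqVneq x y.
    by rewrite yx ltnn in h.
  - by rewrite yx eqz_nat (inj_eq idx_inj) andbb; case: eqP.
have s3i : sinp s3 = inp by rewrite /s3 run_sinp.
clearbody s3.
have h4 := link_ok s3E s3F s3R; set s4 := run _ s3 in h4 *.
have s4E : s4 aE 0 = (idx x)%:Z by rewrite run_frame.
have s4F : s4 aF 0 = (idx y)%:Z by rewrite run_frame.
have h5 := link_ok s4F s4E h4; split; last first.
  by rewrite run_sinp // run_sinp.
split; last by move=> a; do 2 rewrite run_frame //.
apply: reps_ext h5 => a b; rewrite /near /linked !mem_rcons !inE !xpair_eqE.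
by do ![case: (_ == _) | case: (_ \in _)].
Qed.

Lemma read_tuples_ok (T : seq (item I * item I)) B (s : state) :
  (size T <= B)%N ->
  (forall i : 'I_(nsets I), s aOFF (i : nat)%:Z = (off i)%:Z) ->
  tuples_ok [::] s ->
  sinp s = (size T)%:Z :: flatten [seq enc_tuple t | t <- T] ->
  let t := run read_tuples s in loops_le B read_tuples s /\ tuples_ok T t.
Proof.
move=> TB so s0 si; set s' := run (Input aT (Lit 0)) s.
pose J k (t : state) := tuples_ok (take k T) t /\
  sinp t = flatten [seq enc_tuple t | t <- drop k T].
have [||k t kr [Jt Ji] fr|lim [t [Jt _] tE]] :=
  @run_for_le J aI aT read_tuple s' (size T) B _ TB.
- by rewrite /= si.
- by rewrite /J take0 drop0 /= si.
- have lim : loops_le B read_tuple (upd t aI 0 k) by exact: (@within_loops_le pred0).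
  split=> //; have : drop k T != [::] by rewrite -size_eq0 size_drop subn_eq0 -ltnNge.
  case E : (drop k T) => [|[x y] T'] // _.
  have [|||h1 h2] := @read_tuple_ok (take k T) x y
    (flatten [seq enc_tuple t | t <- T']) (upd t aI 0 k).
  + by move=> i; rewrite /= fr //= so.
  + by rewrite /= Ji E.
  + exact: Jt.
  have E' : drop k.+1 T = T' by rewrite -add1n -drop_drop E /= drop0.
  split; last by rewrite E'.
  suff -> : take k.+1 T = rcons (take k T) (x, y) by [].
  by rewrite (take_nth (x, y)) // -[k]addn0 -nth_drop E.
rewrite take_size in Jt; split; first by split.
by rewrite [run read_tuples s](_ : _ = run (For aI aT read_tuple) s') // tE.
Qed.

End Instance.

(** * Matching phases *)

(** For loops that fill the cells [g k] of an array with values [h k] fixed before the loop.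
    Injectivity keeps later iterations off earlier cells, and each iteration may rely on cells not
    yet written being unchanged. *)
Lemma run_for_map (C : cmd) (A i N : nat) c (s : state) n (g h : nat -> int) :
  C = For i N c -> s N 0 = n%:Z -> A != i -> {in gtn n &, injective g} ->
  (forall k (t : state), (k < n)%N ->
     (forall B z, ~~ writes c B -> B != i -> t B z = s B z) ->
     (forall z, (forall k', (k' < k)%N -> z <> g k') -> t A z = s A z) ->
     forall z, run c (upd t i 0 k%:Z) A z = if z == g k then h k else t A z) ->
  (forall k, (k < n)%N -> run C s A (g k) = h k) /\
  (forall z, (forall k, (k < n)%N -> z <> g k) -> run C s A z = s A z).
Proof.
move=> -> sN Ai gI step.
pose J k (t : state) := (forall k', (k' < k)%N -> t A (g k') = h k') /\
  (forall z, (forall k', (k' < k)%N -> z <> g k') -> t A z = s A z).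
have [|k t kn [J1 J2] fr|t [J1 J2] ->] := @run_for J i N c s n sN.
- by split.
- have {}step := step k t kn fr J2; split=> [k'|z hz]; rewrite step.
    rewrite ltnS leq_eqVlt => /orP[/eqP->|kk]; first by rewrite eqxx.
    case: eqP => [e|_]; last exact: J1.
    by move: (kk); rewrite (gI k' k) ?ltnn // !inE ?(ltn_trans kk).
  case: eqP => [e|_]; first by case: (hz k).
  by apply: J2 => k' kk; apply: hz; apply: ltnW.
- split=> [k kn|z hz] /=; rewrite (negPf Ai) /=; first exact: J1.
  exact: J2.
Qed.

Section Main.

Variable I : ris.

Let n := size (items I).
Let m := nsets I.

Implicit Types (a q e : item I) (i : 'I_(nsets I)) (s t : state).

Definition tnear (a b : item I) := near (enum (forbid I)) a b.

Definition rep (a : item I) : item I := [arg min_(b < a | tnear a b) idx b].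
Definition good (a : item I) : bool := (a, a) \notin forbid I.

Let cand := candidate (@tag _ _) rep good.
Let Tree := tree (@tag _ _) rep good (@cst I).
Let Slack := slack (@tag _ _) rep good (@cst I).
Let count := load (@tag 'I_(nsets I) (fun i => 'I_(nitems i))) (Q := item I).

Definition statics : seq nat := [:: aN; aM; aP; aROW; aS; aC; aREP; aBAD].

(** What stays constant once the instance is read and the rows are laid out; its preservation is
    checked by computing [writes] on [statics]. *)
Definition static (s : state) : Prop :=
  [/\ s aN 0 = n%:Z, s aM 0 = m%:Z, forall i, s aP (i : nat) = npick i,
      forall i, s aROW (i : nat) = (i * n)%N &
      forall a, [/\ s aS (idx a) = (tag a : nat), s aC (idx a) = cst a,
                    s aREP (idx a) = idx (rep a) & s aBAD (idx a) = ~~ good a]].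

Lemma static_frame (s t : state) :
  (forall A z, A \in statics -> t A z = s A z) -> static s -> static t.
Proof.
move=> ts [h1 h2 h3 h4 h5]; by split=> [||i|i|a]; rewrite !ts // ?h1.
Qed.

Lemma static_run c s : ~~ has (writes c) statics -> static s -> static (run c s).
Proof.
move=> /hasPn h; apply: static_frame => A z /h wA; exact: run_frame.
Qed.

Lemma static_upd s A z w : A \notin statics -> static s -> static (upd s A z w).
Proof.
by move=> As; apply: static_frame => B y Bs /=; case: eqP => // e; rewrite -e Bs in As.
Qed.

Definition code (o : option (item I)) : int := if o is Some a then (idx a).+1 else 0.

Definition duals (s : state) (u : 'I_(nsets I) -> int) (v : item I -> int) : Prop :=
  (forall i, s aU (i : nat) = u i) /\ forall q, s aV (idx q) = v q.

Definition matched s (X : item I -> option (item I)) : Prop :=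
  forall q, s aX (idx q) = code (X q).

Definition marks s (W : pred 'I_(nsets I)) (M : pred (item I)) : Prop :=
  (forall i, s aMS (i : nat) = (W i : nat)) /\
  forall q, s aMC (idx q) = (M q : nat).

Definition trees s (Y : 'I_(nsets I) -> item I -> option (item I))
    (W : pred 'I_(nsets I)) : Prop :=
  forall i q, W i -> s aY (i * n + idx q)%N = code (Y i q).

Definition red (u : 'I_(nsets I) -> int) (v : item I -> int) (e : item I) : int :=
  cst e - u (tag e) - v (rep e).

Lemma scan_ok s u v W M : static s -> duals s u v -> marks s W M ->
  s aBEST 0 = 0 ->
  let t := run (For aK3 aN scan) s in
  (t aBEST 0 = 0 /\ forall e, ~~ cand W M e) \/
  exists e, [/\ cand W M e, t aBEST 0 = (idx e).+1, t aBD 0 = red u v e &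
                forall e', cand W M e' -> red u v e <= red u v e'].
Proof.
move=> [sN sM sP sR sI] [sU sV] [sW sMc] sB.
pose J k (t : state) :=
  (t aBEST 0 = 0 /\ forall e, (idx e < k)%N -> ~~ cand W M e) \/
  exists e, [/\ cand W M e, t aBEST 0 = (idx e).+1, t aBD 0 = red u v e &
    forall e', (idx e' < k)%N -> cand W M e' -> red u v e <= red u v e'].
have [|k t kn Jk fr|t Jt ->] := @run_for J aK3 aN scan s n sN.
- by left.
- have [a ak] := idx_surj kn; rewrite -ak in Jk *.
  have split_lt e : (idx e < (idx a).+1)%N -> (idx e < idx a)%N \/ e = a.
    by rewrite ltnS leq_eqVlt => /orP[/eqP/idx_inj->|]; [right|left].
  have [h1 h2 h3 h4] := sI a.
  have {}h1 : t aS (idx a) = (tag a : nat) by rewrite fr.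
  have {}h2 : t aC (idx a) = cst a by rewrite fr.
  have {}h3 : t aREP (idx a) = idx (rep a) by rewrite fr.
  have {}h4 : t aBAD (idx a) = ~~ good a by rewrite fr.
  have h5 : t aMS (tag a : nat) = (W (tag a) : nat) by rewrite fr.
  have h6 : t aMC (idx (rep a)) = (M (rep a) : nat) by rewrite fr.
  have h7 : t aU (tag a : nat) = u (tag a) by rewrite fr.
  have h8 : t aV (idx (rep a)) = v (rep a) by rewrite fr.
  have skip : ~~ cand W M a -> J (idx a).+1 (upd t aK3 0 (idx a)).
    move=> nc; case: Jk => [[b0 none]|[e [ce be de me]]]; [left|right].
      by split=> // e /split_lt[/none|->].
    by exists e; split=> // e' /split_lt[/me|->] // /(negP nc).
  rewrite /= h1 h3 h4 h5 h6.
  case Wa : (W (tag a)) => /=; last by apply: skip; rewrite /cand /candidate Wa andbF.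
  case Ma : (M (rep a)) => /=.
    by apply: skip; rewrite /cand /candidate Ma !andbF.
  case ga : (good a) => /=; last by apply: skip; rewrite /cand /candidate ga.
  have ca : cand W M a by rewrite /cand /candidate ga Wa Ma.
  rewrite h2 h7 h8 -/(red u v a).
  case: Jk => [[b0 none]|[e [ce be de me]]].
    rewrite b0 /=; right; exists a; split=> //=; first by rewrite -PoszD addn1.
    by move=> e' /split_lt[/none/negP|->].
  rewrite be de /= subr_gt0; case: ltP => le_red; right; last first.
    by exists e; split=> // e' /split_lt[/me|->].
  exists a; split=> //=; first by rewrite -PoszD addn1.
  move=> e' /split_lt[h|-> //] ce'; apply: le_trans (ltW le_red) _; exact: me.
case: Jt => [[b0 none]|[e [ce be de me]]]; [left|right].
  by split=> // e; apply: none; apply: idx_lt.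
by exists e; split=> // e'; apply: me; apply: idx_lt.
Qed.

(** Uniqueness of division with remainder: rows of length [n] do not overlap. *)
Lemma row_inj (i j a b : nat) : (a < n)%N -> (b < n)%N ->
  (i * n + a = j * n + b)%N -> i = j /\ a = b.
Proof. by move=> an bn; case: (ltngtP i j); nia. Qed.

Lemma raise_u_ok s u v W M d : static s -> duals s u v -> marks s W M ->
  s aBD 0 = d -> forall i, run raise_u s aU (i : nat) = shift_u W u d i.
Proof.
move=> [_ sM _ _ _] [sU _] [sW _] sd i.
have [||k t km fr tz z|h _] := run_for_map (C := raise_u) (A := aU)
  (g := Posz) (h := fun k => if 0 < s aMS k then s aU k + d else s aU k)
  erefl sM.
- by [].
- by move=> x y _ _ [].
- have tk : t aU k = s aU k by apply: tz => k' kk [ke]; rewrite ke ltnn in kk.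
  by rewrite /= !(fr aMS) // (fr aBD) // sd tk; case: ifP => _ //=; case: eqP => // ->.
by rewrite h ?ltn_ord // sW sU /shift_u; case: (W i).
Qed.

Lemma lower_v_ok s u v W M d : static s -> duals s u v -> marks s W M ->
  s aBD 0 = d -> forall q, run lower_v s aV (idx q) = shift_v M v d q.
Proof.
move=> [sN _ _ _ _] [_ sV] [_ sMc] sd q.
have [||k t km fr tz z|h _] := run_for_map (C := lower_v) (A := aV)
  (g := Posz) (h := fun k => if 0 < s aMC k then s aV k - d else s aV k)
  erefl sN.
- by [].
- by move=> x y _ _ [].
- have tk : t aV k = s aV k by apply: tz => k' kk [ke]; rewrite ke ltnn in kk.
  by rewrite /= !(fr aMC) // (fr aBD) // sd tk; case: ifP => _ //=; case: eqP => // ->.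
by rewrite h ?idx_lt // sMc sV /shift_v; case: (M q).
Qed.

Lemma copy_row_ok s (i j : 'I_(nsets I)) : static s -> i != j ->
  s aG 0 = (i : nat) -> s aH 0 = (j : nat) ->
  (forall q, run copy_row s aY (j * n + idx q)%N = s aY (i * n + idx q)%N) /\
  (forall (k : 'I_(nsets I)) q, k != j ->
     run copy_row s aY (k * n + idx q)%N = s aY (k * n + idx q)%N).
Proof.
move=> [sN _ _ sR _] ij sG sH.
have [||k t km fr tz z|h1 h2] := run_for_map (C := copy_row) (A := aY)
  (g := fun k => (j * n + k)%N) (h := fun k => s aY (i * n + k)%N) erefl sN.
- by [].
- by move=> x y xn yn [/row_inj[]//].
- rewrite /= !(fr aROW) // (fr aG) // (fr aH) // sG sH !sR -!PoszD.
  (* Rows of different sets are disjoint, so the source row is still intact. *)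
  rewrite (tz (i * n + k)%N) // => k' kk [/row_inj h].
  have [||e _] := h; [by []|exact: ltn_trans kk km|].
  by rewrite (val_inj e) eqxx in ij.
split=> [q|k q kj]; first exact/h1/idx_lt.
apply: h2 => x xn [/row_inj h]; have [||e _] := h; [exact: idx_lt|by []|].
by rewrite (val_inj e) eqxx in kj.
Qed.

Lemma adopt_row_ok s (i : 'I_(nsets I)) : static s -> s aG 0 = (i : nat) ->
  forall q, run adopt_row s aX (idx q) = s aY (i * n + idx q)%N.
Proof.
move=> [sN _ _ sR _] sG q.
have [||k t km fr tz z|h1 _] := run_for_map (C := adopt_row) (A := aX)
  (g := Posz) (h := fun k => s aY (i * n + k)%N) erefl sN.
- by [].
- by move=> x y _ _ [].
- by rewrite /= !(fr aROW) // (fr aG) // sG sR -PoszD (fr aY).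
exact/h1/idx_lt.
Qed.

(** * Rounds and phases *)

Definition grown (X : item I -> option (item I)) (root : 'I_(nsets I)) s : Prop :=
  s aDONE 0 = 1 /\ exists X' u v, [/\ duals s u v, matched s X', Slack u v X' &
    forall i, count X' i = (count X i + (i == root))%N].

(** [P] is a parameter because the same shape is used with two conditions: one more marked column
    after a round, and the progress measure of a phase. *)
Definition growing X (root : 'I_(nsets I)) (P : pred (item I) -> pred 'I_(nsets I) -> Prop) s : Prop :=
  s aDONE 0 = 0 /\ exists Y u v W M, [/\ duals s u v, matched s X,
    marks s W M /\ trees s Y W, Tree root X Y u v W M & P M W].

(** Column [rep e] is already marked in memory, while the tree is still the one over [M]. Whether or
    not the set of [e'] is new, the number of marked columns rises by one. *)
Lemma extend_ok s X u v W M Y root e e' :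
  static s -> duals s u v -> matched s X ->
  marks s W (fun q => (q == rep e) || M q) -> trees s Y W ->
  Tree root X Y u v W M -> cand W M e -> cst e = u (tag e) + v (rep e) ->
  X (rep e) = Some e' -> s aBEST 0 = (idx e).+1 -> s aG 0 = (tag e : nat) ->
  s aQ 0 = idx (rep e) -> s aDONE 0 = 0 ->
  growing X root (fun M' _ => #|M'| = #|M|.+1) (run extend s).
Proof.
move=> st du ma mk tr Tr ce te Xq sB sG sQ sD.
have cM' : #|fun q => (q == rep e) || M q| = #|M|.+1.
  have -> : #|fun q => (q == rep e) || M q| = #|predU1 (rep e) M| by apply: eq_card.
  by rewrite cardU1 [rep e \in M]/in_mem /=; case/and3P: ce => _ _ ->.
pose s1 := upd s aH 0 (tag e' : nat).
rewrite /extend run_seq.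
have -> : run (Set0 aH (Get aS (Dif (Get aX (Var aQ)) (Lit 1)))) s = s1.
  rewrite /= sQ ma Xq /= -[X in s aS X](_ : (idx e')%:Z = _); last by lia.
  by case: st => _ _ _ _ /(_ e')[->].
have st1 : static s1 by exact: static_upd.
have tm := tree_mark Tr ce te erefl Xq.
case: (mk) => mW mM; rewrite /Unless run_if [ev _ _]/= mW; have [We'|We'] := boolP (W (tag e')).
  split=> //; exists Y, u, v, W, (fun q => (q == rep e) || M q); split=> //.
  apply: tm => //; last by rewrite We'.
  by move=> i; case: eqP => // ->.
set s2 := run (Put aMS (Var aH) (Lit 1)) s1.
have s2M i : s2 aMS (i : nat) = ((i == tag e') || W i : nat).
  by rewrite /= eqz_nat -val_eqE mW; case: (_ == _).
have st2 : static s2 by apply: static_run st1.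
have ee : tag e != tag e' by apply: contra We' => /eqP <-; case/and3P: ce.
have [c1 c2] := copy_row_ok st2 ee sG (erefl : s2 aH 0 = (tag e' : nat)).
have st3 : static (run copy_row s2) by apply: static_run st2.
have fr3 A z : A != aY -> A != aK3 -> run copy_row s2 A z = s2 A z.
  by move=> h1 h2; rewrite run_frame //= negb_or h1 h2.
rewrite run_seq -/s2 (run_seq copy_row).
set s3 := run copy_row s2 in c1 c2 st3 fr3 *; set s4 := run _ s3.
have s4Y z : s4 aY z = if z == (tag e' * n + idx (rep e))%N then (idx e).+1 : int
                       else s3 aY z.
  rewrite /s4; case: st3 => _ _ _ sR _.
  have h1 : s3 aH 0 = (tag e' : nat) by rewrite fr3.
  have h2 : s3 aQ 0 = idx (rep e) by rewrite fr3 //= sQ.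
  have h3 : s3 aBEST 0 = (idx e).+1 by rewrite fr3 //= sB.
  by clearbody s3; rewrite /= h1 h2 h3 sR -PoszD.
have fr4 A z : A != aY -> A != aK3 -> A != aH -> A != aMS -> s4 A z = s A z.
  move=> hY hK hH hM; rewrite /s4 run_frame // fr3 // /s2 run_frame //.
  by rewrite /s1 /= (negPf hH).
have s4M i : s4 aMS (i : nat) = ((i == tag e') || W i : nat).
  by rewrite -s2M /s4 run_frame // fr3.
clearbody s4; clearbody s3.
split; first by rewrite fr4.
(* Row [tag e'] now holds the copied matching of [tag e] with column [rep e] reassigned to [e]. *)
pose Y' i q := if i == tag e' then (if q == rep e then Some e else Y (tag e) q)
               else Y i q.
exists Y', u, v, (fun i => (i == tag e') || W i), (fun q => (q == rep e) || M q).
split=> //.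
- by case: du => h1 h2; split=> x; rewrite fr4.
- by move=> q; rewrite fr4.
- split; first by split=> [|q]; [exact: s4M | rewrite fr4 // mM].
  have We : W (tag e) by case/and3P: ce.
  move=> i q; rewrite s4Y /Y'; have [->|ie /= Wi] := eqVneq i (tag e'); last first.
    case: eqP => [[/row_inj h]|_].
      have [||k _] := h; [exact: idx_lt|exact: idx_lt|].
      by rewrite (val_inj k) eqxx in ie.
    by rewrite c2 // -tr.
  move=> _ /=; rewrite eqz_nat eqn_add2l (inj_eq (@idx_inj I)); case: eqP => // _.
  by rewrite c1 -tr.
- apply: tm => // [i Wi q|_ q]; rewrite /Y'; last by rewrite eqxx.
  by case: eqP => // ie; rewrite -ie Wi in We'.
Qed.

Lemma augment_ok s X u v W M Y root e :
  static s -> duals s u v -> trees s Y W ->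
  Tree root X Y u v W M -> cand W M e -> cst e = u (tag e) + v (rep e) ->
  X (rep e) = None -> s aBEST 0 = (idx e).+1 -> s aG 0 = (tag e : nat) ->
  s aQ 0 = idx (rep e) -> grown X root (run augment s).
Proof.
move=> st du tr Tr ce te Xq sB sG sQ.
set s1 := run (Set0 aDONE (Lit 1)) s.
have st1 : static s1 by apply: static_run st.
have r1 := adopt_row_ok st1 sG.
rewrite /augment run_seq -/s1 run_seq; set s2 := run adopt_row s1 in r1 *.
have fr A z : A != aX -> A != aK3 -> s2 A z = s1 A z.
  by move=> h1 h2; rewrite /s2 run_frame //= negb_or h1 h2.
have sQ2 : s2 aQ 0 = idx (rep e) by rewrite fr.
have sB2 : s2 aBEST 0 = (idx e).+1 by rewrite fr.
clearbody s2; set s3 := run _ s2.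
have s3X q : s3 aX (idx q) = code (if q == rep e then Some e else Y (tag e) q).
  rewrite /s3 /= sQ2 sB2 eqz_nat (inj_eq (@idx_inj I)); case: eqP => // _.
  by rewrite r1 -tr //; case/and3P: ce.
have fr3 A z : A != aX -> A != aK3 -> s3 A z = s1 A z.
  by move=> h1 h2; rewrite /s3 run_frame // fr.
clearbody s3; split; first by rewrite fr3.
pose X' q := if q == rep e then Some e else Y (tag e) q.
have [sl cX] := tree_done (X' := X') Tr ce te erefl Xq (fun=> erefl).
exists X', u, v; split=> //.
by case: du => h1 h2; split=> x; rewrite fr3 // -(h1, h2).
Qed.

(** The potentials are shifted while the marks still describe the old tree. The shift makes [e]
    tight, and only then is its column marked. *)
Lemma advance_ok s X u v W M Y root e :
  static s -> duals s u v -> matched s X -> marks s W M -> trees s Y W ->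
  Tree root X Y u v W M -> cand W M e -> s aBEST 0 = (idx e).+1 ->
  s aBD 0 = red u v e -> (forall e', cand W M e' -> red u v e <= red u v e') ->
  s aDONE 0 = 0 ->
  grown X root (run advance s) \/
  growing X root (fun M' _ => #|M'| = #|M|.+1) (run advance s).
Proof.
move=> st du ma mk tr Tr ce sB sd dmin sD.
set s1 := run locate s.
have fr1 A z : A != aE -> A != aG -> A != aQ -> s1 A z = s A z.
  by move=> h1 h2 h3; rewrite /s1 run_frame //= !negb_or h1 h2 h3.
have [sE sG sQ] : [/\ s1 aE 0 = idx e, s1 aG 0 = (tag e : nat) & s1 aQ 0 = idx (rep e)].
  rewrite /s1 /= sB -[_ - 1](_ : (idx e)%:Z = _); last by lia.
  by case: st => _ _ _ _ /(_ e)[-> _ ->].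
have st1 : static s1 by apply: static_run st.
have du1 : duals s1 u v by case: du => h1 h2; split=> x; rewrite fr1.
have mk1 : marks s1 W M by case: mk => h1 h2; split=> x; rewrite fr1.
have sd1 : s1 aBD 0 = red u v e by rewrite fr1.
have hu := raise_u_ok st1 du1 mk1 sd1.
set s2 := run raise_u s1 in hu.
have fr2 A z : A != aU -> A != aK3 -> s2 A z = s1 A z.
  by move=> h1 h2; rewrite /s2 run_frame //= orbF negb_or h1 h2.
have st2 : static s2 by apply: static_run st1.
have du2 : duals s2 (shift_u W u (red u v e)) v.
  by split=> [//|x]; rewrite fr2 //; case: du1.
have mk2 : marks s2 W M by case: mk1 => h1 h2; split=> x; rewrite fr2.
have sd2 : s2 aBD 0 = red u v e by rewrite fr2.
have hv := lower_v_ok st2 du2 mk2 sd2.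
set s3 := run lower_v s2 in hv.
have fr3 A z : A != aV -> A != aK3 -> s3 A z = s2 A z.
  by move=> h1 h2; rewrite /s3 run_frame //= orbF negb_or h1 h2.
have st3 : static s3 by apply: static_run st2.
set s4 := run (Put aMC (Var aQ) (Lit 1)) s3.
have st4 : static s4 by apply: static_run st3.
have fr4 A z : A != aMC -> s4 A z = s3 A z.
  by move=> h1; rewrite /s4 run_frame.
have mk4 : marks s4 W (fun q => (q == rep e) || M q).
  case: mk2 => h1 h2; split=> x; first by rewrite fr4 // fr3.
  have sQ3 : s3 aQ 0 = idx (rep e) by rewrite fr3 // fr2.
  rewrite /s4; have := fr3 aMC (idx x); clearbody s3 => f3.
  rewrite /= sQ3 eqz_nat (inj_eq (@idx_inj I)) f3 // h2.
  by case: (x == rep e).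
have -> : run advance s = run (If (Get aX (Var aQ)) extend augment) s4.
  rewrite /advance (run_seq locate) -/s1 (run_seq raise_u) -/s2.
  by rewrite (run_seq lower_v) -/s3 (run_seq (Put aMC (Var aQ) (Lit 1))).
have [Tr' te] := tree_shift Tr ce erefl dmin.
have du4 : duals s4 (shift_u W u (red u v e)) (shift_v M v (red u v e)).
  by split=> x; rewrite fr4 // fr3.
have ma4 : matched s4 X by move=> q; rewrite fr4 // fr3 // fr2 // fr1.
have tr4 : trees s4 Y W by move=> i q Wi; rewrite fr4 // fr3 // fr2 // fr1 // tr.
have sB4 : s4 aBEST 0 = (idx e).+1 by rewrite fr4 // fr3 // fr2 // fr1.
have sG4 : s4 aG 0 = (tag e : nat) by rewrite fr4 // fr3 // fr2.
have sQ4 : s4 aQ 0 = idx (rep e) by rewrite fr4 // fr3 // fr2.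
have sD4 : s4 aDONE 0 = 0 by rewrite fr4 // fr3 // fr2 // fr1.
clearbody s4; rewrite run_if [ev _ _]/= sQ4 ma4; case Xq : (X (rep e)) => [e'|] /=.
  by right; apply: (extend_ok st4 du4 ma4 mk4 tr4 Tr' ce te Xq).
by left; apply: (augment_ok st4 du4 tr4 Tr' ce te Xq).
Qed.

Definition stuck (X : item I -> option (item I)) (root : 'I_(nsets I)) : Prop :=
  exists Y u v W M, Tree root X Y u v W M /\ forall e, ~~ cand W M e.

(** The measure of a phase: after [k] rounds the search has augmented, has marked at least [k]
    columns, or cannot grow. *)
Definition progress X root k s : Prop :=
  static s /\ (grown X root s \/
    growing X root (fun M W => (k <= #|M|)%N \/ forall e, ~~ cand W M e) s).

Lemma grow_ok X root k s : progress X root k s -> progress X root k.+1 (run grow s).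
Proof.
case=> st h; split; first by apply: static_run st.
case: h => [[sD h]|[sD [Y [u [v [W [M [du ma [mk tr] Tr kM]]]]]]]].
  by rewrite /grow /Unless run_if [ev _ _]/= sD; left.
have -> : run grow s = run (When (Var aBEST) advance) (run search s).
  by rewrite /grow /Unless run_if [ev _ _]/= sD ltxx (run_seq search).
set s1 := run (Set0 aBEST (Lit 0)) s.
have -> : run search s = run (For aK3 aN scan) s1 by rewrite /search run_seq.
have st1 : static s1 by apply: static_run st.
have sc := scan_ok st1 du mk (erefl : s1 aBEST 0 = 0).
set s2 := run _ s1 in sc *.
have fr A z : ~~ writes search A -> s2 A z = s A z.
  by case/norP=> h1 h2; rewrite /s2 run_frame // /s1 run_frame.
have st2 : static s2 by apply: static_run st1.
have du2 : duals s2 u v by case: du => h1 h2; split=> x; rewrite fr.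
have ma2 : matched s2 X by move=> q; rewrite fr.
have mk2 : marks s2 W M by case: mk => h1 h2; split=> x; rewrite fr.
have tr2 : trees s2 Y W by move=> i q Wi; rewrite fr // tr.
have sD2 : s2 aDONE 0 = 0 by rewrite fr.
clearbody s2.
case: sc => [[sB noc]|[e [ce sB sd dmin]]].
  have -> : run (When (Var aBEST) advance) s2 = s2.
    by rewrite /When run_if [ev _ _]/= sB ltxx.
  right; split=> //; exists Y, u, v, W, M; split=> //.
  by right.
have -> : run (When (Var aBEST) advance) s2 = run advance s2.
  by rewrite /When run_if [ev _ _]/= sB ltz_nat ltn0Sn.
have [|[sD' [Y' [u' [v' [W' [M' [h1 h2 h3 h4 h5]]]]]]]] :=
  advance_ok st2 du2 ma2 mk2 tr2 Tr ce sB sd dmin sD2; first by left.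
right; split=> //; exists Y', u', v', W', M'; split=> //.
(* The candidate [e] excludes the stuck alternative, so at least [k] marked columns become at least
   [k + 1]. *)
by case: kM => [kM|/(_ e)/negP//]; left; rewrite h5.
Qed.

Lemma clear_sets_ok s i : static s -> run clear_sets s aMS (i : nat) = 0.
Proof.
move=> [_ sM _ _ _].
have [||k t km fr tz z|h1 _] := run_for_map (C := clear_sets) (A := aMS)
  (g := Posz) (h := fun=> 0) erefl sM.
- by [].
- by move=> x y _ _ [].
- by [].
exact: h1.
Qed.

Lemma clear_cols_ok s (i : 'I_(nsets I)) : static s -> s aI 0 = (i : nat) -> forall q,
  run clear_cols s aMC (idx q) = 0 /\
  run clear_cols s aY (i * n + idx q)%N = s aX (idx q).
Proof.
move=> [sN _ _ sR _] sI q; split.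
  have [||k t km fr tz z|h1 _] := run_for_map (C := clear_cols) (A := aMC)
    (g := Posz) (h := fun=> 0) erefl sN.
  - by [].
  - by move=> x y _ _ [].
  - by [].
  exact/h1/idx_lt.
have [||k t km fr tz z|h1 _] := run_for_map (C := clear_cols) (A := aY)
  (g := fun k => (i * n + k)%N) (h := fun k => s aX k) erefl sN.
- by [].
- by move=> x y xn yn [/row_inj[]//].
- by rewrite /= (fr aROW) // (fr aX) // (fr aI) // sI sR -PoszD.
exact/h1/idx_lt.
Qed.

Lemma plant_ok s u v X (root : 'I_(nsets I)) : static s -> duals s u v -> matched s X ->
  Slack u v X -> s aI 0 = (root : nat) -> progress X root 0 (run plant s).
Proof.
move=> st du ma sl sI; split; first by apply: static_run st.
right; set s1 := run clear_sets s; set s2 := run clear_cols s1.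
set s3 := run (Put aMS (Var aI) (Lit 1)) s2.
have -> : run plant s = run (Set0 aDONE (Lit 0)) s3.
  by rewrite /plant (run_seq clear_sets) (run_seq clear_cols) run_seq.
have st1 : static s1 by apply: static_run st.
have st2 : static s2 by apply: static_run st1.
have cs i := clear_sets_ok i st.
have sI1 : s1 aI 0 = (root : nat) by rewrite run_frame.
have sI2 : s2 aI 0 = (root : nat) by rewrite run_frame.
have cc := clear_cols_ok st1 sI1.
have fr A z : ~~ writes plant A -> run (Set0 aDONE (Lit 0)) s3 A z = s A z.
  case/norP=> h1 /norP[h2 /norP[h3 h4]].
  by do 4 rewrite run_frame //.
have sMS i : s3 aMS (i : nat) = (i == root : nat).
  rewrite /s3; have := run_frame (c := clear_cols) (A := aMS) s1 (i : nat) isT.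
  rewrite -/s2 cs; clearbody s2 => f2; rewrite /= sI2 eqz_nat val_eqE f2.
  by case: (i == root).
have sMC q : s3 aMC (idx q) = 0 by rewrite run_frame //; case: (cc q).
have sY q : s3 aY (root * n + idx q)%N = code (X q).
  by rewrite run_frame //; case: (cc q) => _ ->; rewrite run_frame // ma.
split=> //; exists (fun=> X), u, v, (pred1 root), pred0; split.
- by case: du => h1 h2; split=> x; rewrite fr.
- by move=> q; rewrite fr.
- split; first by split=> x; rewrite run_frame // (sMS, sMC).
  by move=> i q /eqP->; rewrite run_frame.
- exact: tree_init.
- by left.
Qed.

Lemma card_items : #|{: item I}| = n.
Proof.
rewrite /n -(card_uniqP (items_uniq I)); apply: eq_card => a.
by rewrite !inE mem_items.
Qed.

Lemma phase_ok s u v X (root : 'I_(nsets I)) : static s -> duals s u v -> matched s X ->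
  Slack u v X -> s aI 0 = (root : nat) -> s aFAIL 0 = 0 ->
  let t := run phase s in
  static t /\
  ((t aFAIL 0 = 0 /\ exists X' u v, [/\ duals t u v, matched t X', Slack u v X' &
      forall i, count X' i = (count X i + (i == root))%N]) \/
   (t aFAIL 0 = 1 /\ stuck X root)).
Proof.
move=> st du ma sl sI sF; split; first by apply: static_run st.
have pl := plant_ok st du ma sl sI; set s1 := run plant s in pl.
have st1 : static s1 by case: pl.
have [||k t kn pk fr|t pn tE] := @run_for (progress X root) aK2 aN grow s1 n.
- by case: st1.
- exact: pl.
- by apply: grow_ok; exact: pk.
have {}pn : progress X root n (run (For aK2 aN grow) s1).
  by rewrite tE.
have sF2 : run (For aK2 aN grow) s1 aFAIL 0 = 0.
  by rewrite run_frame // /s1 run_frame.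
rewrite /phase run_seq -/s1 (run_seq (For aK2 aN grow)).
move: (run _ s1) pn sF2 => s2 [st2 [[sD gr]|[sD [Y [u' [v' [W [M [du2 ma2 [mk tr] Tr nM]]]]]]]]] sF2.
  by rewrite /Unless run_if [ev _ _]/= sD; left.
have -> : run (Unless (Var aDONE) (Set0 aFAIL (Lit 1))) s2 = upd s2 aFAIL 0 1.
  by rewrite /Unless run_if [ev _ _]/= sD ltxx.
right; split=> //; exists Y, u', v', W, M; split=> // e.
case: nM => [nM|/(_ e)//]; apply/negP => /and3P[_ _ /negP[]].
(* Columns are indexed by items, so [n] marked columns are all of them and none is left for a
   candidate. *)
have /subset_leqif_card[_ /esym] := subset_predT M.
by rewrite eqn_leq max_card card_items nM => /subsetP /(_ (rep e)); apply.
Qed.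

(** * Serving all demands *)

Definition none_feasible : Prop := forall y, ~ picks (@tag _ _) rep good (@npick I) y.

Definition partial (d : 'I_(nsets I) -> nat) s : Prop :=
  static s /\
  ((s aFAIL 0 = 0 /\ exists X u v, [/\ duals s u v, matched s X, Slack u v X &
      forall i, count X i = d i]) \/
   (s aFAIL 0 = 1 /\ none_feasible)).

Lemma partial_upd d d' s A z w : d =1 d' ->
  A \notin [:: aFAIL; aU; aV; aX] ++ statics ->
  partial d s -> partial d' (upd s A z w).
Proof.
move=> dd hA [st h]; have fr B y : B \in [:: aFAIL; aU; aV; aX] ->
    upd s A z w B y = s B y.
  move=> hB /=; case: eqP => // e; case/negP: hA.
  by rewrite mem_cat -e hB.
split; first by apply: static_upd st; move: hA; rewrite mem_cat negb_or => /andP[].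
case: h => [[sF [X [u [v [du ma sl cX]]]]]|[sF no]]; [left|right].
  split; first by rewrite fr.
  exists X, u, v; split=> //; last by move=> i; rewrite cX.
    by case: du => h1 h2; split=> x; rewrite fr.
  by move=> q; rewrite fr.
by split=> //; rewrite fr.
Qed.

Lemma nitems_le_n i : (nitems i <= n)%N.
Proof.
have <- : size (its i) = nitems i by rewrite size_map size_enum_ord.
apply: uniq_leq_size => [|a _]; last exact: mem_items.
rewrite map_inj_uniq ?enum_uniq // => a b /eqP.
by rewrite -tag_eqE /tag_eq eqxx /= tagged_asE => /eqP.
Qed.

Lemma npick_le_n i : (npick i <= n)%N.
Proof. by have := npickP i; have := nitems_le_n i; lia. Qed.

(** The demand met when the sets before [i] are finished and [k] iterations for [i] are over; the
    minimum accounts for idle iterations. *)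
Definition served (i : 'I_(nsets I)) k (j : 'I_(nsets I)) : nat :=
  if (j < i)%N then npick j else if j == i then minn k (npick j) else 0.

Lemma serve_ok (i : 'I_(nsets I)) (k : nat) s : s aI 0 = (i : nat) -> s aK1 0 = k ->
  partial (served i k) s -> partial (served i k.+1) (run serve s).
Proof.
move=> sI sK pk; have [st h] := pk.
have sP : s aP (i : nat) = npick i by case: st.
rewrite /serve /When run_if [ev _ _]/= sI sK sP subr_gt0 ltz_nat.
have same : (npick i <= k)%N -> served i k =1 served i k.+1.
  move=> ki j; rewrite /served; case: ifP => // _; case: eqP => // ->.
  by rewrite !(minn_idPr _) // ltnW.
case: ltnP => [ki|/same kk]; last first.
  split=> //; case: h => [[sF [X [u [v [du ma sl cX]]]]]|]; [left|by right].
  by split=> //; exists X, u, v; split=> // j; rewrite cX kk.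
case: h => [[sF [X [u [v [du ma sl cX]]]]]|[sF no]]; last first.
  by rewrite /Unless run_if [ev _ _]/= sF; split=> //; right.
have -> : run (Unless (Var aFAIL) phase) s = run phase s.
  by rewrite /Unless run_if [ev _ _]/= sF ltxx.
have [st' ph] := phase_ok st du ma sl sI sF; split=> //.
case: ph => [[sF' [X' [u' [v' [du' ma' sl' cX']]]]]|[sF' [Y [u' [v' [W [M [Tr noc]]]]]]]].
  left; split=> //; exists X', u', v'; split=> // j; rewrite cX' cX /served.
  case: ifP => ji; first by case: eqP ji => [->|]; rewrite ?ltnn // addn0.
  by case: eqP => [->|//]; lia.
right; split=> // y; apply: (tree_stuck Tr noc); last first.
  by rewrite -/(count X i) cX /served ltnn eqxx; lia.
move=> j; rewrite -/(count X j) cX /served; case: ifP => // _.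
by case: ifP => // _; apply: geq_minr.
Qed.

Lemma solve_ok s : static s -> s aFAIL 0 = 0 ->
  (forall i (a : item I), tag a = i -> s aU (i : nat) <= cst a) ->
  (forall q, s aV (idx q) = 0) -> (forall q, s aX (idx q) = 0) ->
  partial (@npick I) (run solve s).
Proof.
move=> st sF sU sV sX.
pose J k t := partial (fun j : 'I_(nsets I) => if (j < k)%N then npick j else 0%N) t.
have [||k t km pk fr|t pt ->] := @run_for J aI aM (For aK1 aN serve) s m.
- by case: st.
- split=> //; left; split=> //.
  (* The empty matching, the potentials collected while reading, and [v = 0]. *)
  exists (fun=> None), (fun i => s aU (i : nat)), (fun=> 0); split=> //.
  + by split=> //; split=> // a _ /=; rewrite addr0 sU.
  + by move=> i; rewrite /count /load big1.
- pose i := Ordinal km.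
  have st0 : static (upd t aI 0 k) by apply: static_upd; case: pk.
  have [||k' t' kn' pk' fr'|t' pt' ->] :=
    @run_for (fun k t => partial (served i k) t) aK1 aN serve (upd t aI 0 k) n.
  + by case: st0.
  + apply: partial_upd pk => // j; rewrite /served -val_eqE /=.
    by case: ifP => // _; case: eqP => // _; rewrite min0n.
  + by apply: serve_ok => //; rewrite /= fr'.
  apply: partial_upd pt' => // j; rewrite /served -val_eqE /= ltnS.
  (* The [n] iterations exhaust the demand, since [npick] is at most [n]. *)
  by case: ltngtP => // _; rewrite (minn_idPr (npick_le_n j)).
by apply: partial_upd pt => // j; rewrite ltn_ord.
Qed.

End Main.

(** * The answer *)

Section Answer.

Variable I : ris.

Implicit Types (a b : item I) (i : 'I_(nsets I)) (s : state).

Lemma rows_ok s (n : nat) : s aN 0 = n -> s aM 0 = nsets I -> s aROW 0 = 0 ->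
  forall i : 'I_(nsets I), run rows s aROW (i : nat) = (i * n)%N.
Proof.
move=> sN sM s0 i.
have [|k t km Jk fr|t Jt tE] := @run_for
  (fun k t => forall j, (j <= k)%N -> t aROW j = (j * n)%N) aI aM
  (Put aROW (Add (Var aI) (Lit 1)) (Add (Get aROW (Var aI)) (Var aN))) s
  (nsets I) sM.
- by case.
- move=> j; rewrite /= Jk // (fr aN) // sN -!PoszD addn1 eqz_nat.
  rewrite leq_eqVlt => /orP[/eqP->|]; first by rewrite eqxx mulSn addnC.
  by rewrite ltnS => jk; rewrite ltn_eqF ?ltnS // Jk.
rewrite /rows tE /=; exact/Jt/ltnW.
Qed.

(** * Representatives and cliques *)

Lemma idx_rep a b : is_min (tnear a) b -> b = rep a.
Proof.
case=> ab bm; rewrite /rep; case: arg_minnP => [|c ac cm].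
  by rewrite /tnear /near eqxx.
by apply/idx_inj/eqP; rewrite eqn_leq bm ?cm.
Qed.

Lemma rep_near a : tnear a (rep a).
Proof. by rewrite /rep; case: arg_minnP => //; rewrite /tnear /near eqxx. Qed.

Lemma rep_min a b : tnear a b -> (idx (rep a) <= idx b)%N.
Proof.
by rewrite /rep; case: arg_minnP => [|c _ cm]; [rewrite /tnear /near eqxx|apply: cm].
Qed.

Lemma tnearE a b : tnear a b = (b == a) || forbidden a b.
Proof. by rewrite /tnear /near /linked !mem_enum. Qed.

Lemma forbiddenC a b : forbidden a b = forbidden b a.
Proof. by rewrite /forbidden orbC. Qed.

(** For forbidden items transitivity makes the closed neighbourhoods equal, hence their least
    elements too. Conversely, two distinct items near a common representative are forbidden with
    each other. The diagonal is left to [good]. *)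
Lemma rep_eq a b : forbidden_transitive I -> a != b ->
  (rep a == rep b) = forbidden a b.
Proof.
move=> tr ab; apply/eqP/idP => [rr|].
  have := rep_near a; have := rep_near b; rewrite -rr !tnearE.
  case: (eqVneq (rep a) b) => [rb _|rb /= fb].
    by rewrite rb eq_sym (negPf ab).
  move=> /predU1P[ra|fa]; first by rewrite -ra forbiddenC.
  by apply: tr ab fa _; rewrite forbiddenC.
have sub (x y : item I) : x != y -> forbidden x y -> (idx (rep y) <= idx (rep x))%N.
  move=> xy fxy; apply: rep_min; have := rep_near x; rewrite !tnearE.
  case/predU1P=> [->|fx]; first by rewrite forbiddenC fxy orbT.
  have [//|ry] := eqVneq (rep x) y; apply: (tr _ x) => //; first by rewrite eq_sym.
  by rewrite forbiddenC.
move=> fab; apply/idx_inj/eqP; rewrite eqn_leq !sub // 1?eq_sym //.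
by rewrite forbiddenC.
Qed.

Lemma sum_tag (R : nmodType) (F : item I -> R) i :
  \sum_(a | tag a == i) F a = \sum_(j < nitems i) F (mk j).
Proof.
transitivity (\sum_(k | k == i) \sum_(j < nitems k) F (mk j)).
  by rewrite sig_big_dep; apply: eq_big => [a|[k j]] //; rewrite andbT.
by rewrite big_pred1_eq.
Qed.

Definition sel (y : pred (item I)) : selection I := fun i j => y (mk j).

Definition unsel (x : selection I) : pred (item I) := fun a => x (tag a) (tagged a).

Lemma selK y : unsel (sel y) =1 y.
Proof. by case. Qed.

Lemma value_unsel x : value x = \sum_a cst a * (unsel x a : nat)%:Z.
Proof.
rewrite /value sig_big_dep; apply: eq_bigr => -[i j] _ //.
Qed.

Lemma feasible_picks x : forbidden_transitive I -> feasible x ->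
  picks (@tag _ _) (@rep I) (@good I) (@npick I) (unsel x).
Proof.
move=> tr [xs xf]; split.
- by move=> i; rewrite (@sum_tag nat) -xs.
(* A tuple [(a, a)] reads [2 x <= 1], which bans the item. *)
- move=> a ya; apply/negP => /xf; rewrite -/(unsel x a) ya //.
- move=> a b ya yb /eqP; apply: contraTeq => ab; rewrite rep_eq //.
  apply/negP => /orP[] /xf; rewrite -/(unsel x a) -/(unsel x b) ya yb //.
Qed.

Lemma picks_feasible y : forbidden_transitive I ->
  picks (@tag _ _) (@rep I) (@good I) (@npick I) y -> feasible (sel y).
Proof.
move=> tr [ys yg yi]; split=> [i|a b ab].
  by rewrite -ys (@sum_tag nat).
rewrite -/(unsel (sel y) a) -/(unsel (sel y) b) !selK.
case ya : (y a) => //; case yb : (y b) => //.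
have [e|ne] := eqVneq a b; first by have := yg a ya; rewrite /good {2}e ab.
have : rep a == rep b by rewrite rep_eq // /forbidden ab.
by move=> /eqP /(yi _ _ ya yb) e; rewrite e eqxx in ne.
Qed.

Lemma print_answer_ok s X : static I s -> s aFAIL 0 = 0 -> matched s X ->
  sout s = [::] ->
  sout (run print_answer s) = 1 :: enc_selection (sel (chosen (@rep I) X)).
Proof.
move=> [sN _ _ _ sI] sF ma so.
set s1 := run (Output (Lit 1)) s.
have -> : run print_answer s = run (For aK3 aN print_item) s1.
  by rewrite /print_answer run_if [ev _ _]/= sF ltxx run_seq.
pose f a : int := (chosen (@rep I) X a : nat)%:Z.
have [||k t kn Jk fr|t Jt ->] := @run_for
  (fun k t => sout t = 1 :: [seq f a | a <- take k (items I)])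
  aK3 aN print_item s1 (size (items I)).
- by [].
- by rewrite take0 /= so.
- have [a ak] := idx_surj kn.
  have -> : take k.+1 (items I) = rcons (take k (items I)) a.
    by rewrite (take_nth a) // -ak nth_index ?mem_items.
  have h1 : t aREP (k : nat) = idx (rep a) by rewrite fr // -ak; case: (sI a).
  have h2 : t aX (idx (rep a)) = code (X (rep a)) by rewrite fr // ma.
  rewrite map_rcons -rcons_cons -Jk /= h1 h2 /f /chosen -ak.
  case: (X (rep a)) => [b|] /=; last by rewrite ltNge subr_le0 le0z_nat.
  have -> : (Some b == Some a) = (idx b == idx a).
    by rewrite (inj_eq (@idx_inj I)); apply/eqP/eqP => [[]|->].
  by case: ifP => h; [case: ifP => h'|]; congr rcons; case: eqP => //; lia.
- by rewrite /= Jt take_size; congr cons; rewrite map_flatten -map_comp;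
    congr flatten; apply: eq_map => i /=; rewrite -map_comp.
Qed.

(** * Input size and assembly *)

Definition tuples_input : seq int :=
  #|forbid I|%:Z :: flatten [seq enc_tuple t | t <- enum (forbid I)].

Lemma enc_risE : enc_ris I = (nsets I)%:Z ::
  flatten [seq enc_set i | i <- enum 'I_(nsets I)] ++ tuples_input.
Proof. by []. Qed.

Lemma size_enc_sets (l : seq 'I_(nsets I)) :
  size (flatten [seq enc_set i | i <- l]) =
  (2 * size l + size (flatten [seq its i | i <- l]))%N.
Proof.
by elim: l => //= i l IHl; rewrite !size_cat IHl !size_map; lia.
Qed.

Lemma size_enc_tuples (l : seq (item I * item I)) :
  (size l <= size (flatten [seq enc_tuple t | t <- l]))%N.
Proof. by elim: l => //= t l IHl; lia. Qed.

Lemma size_input (a : seq int) : (size a <= input_size a)%N.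
Proof.
rewrite /input_size -sum1_size; apply: leq_sum => z _; rewrite /bitlen; lia.
Qed.

(** Every set, item and tuple contributes at least one integer to the input, and each integer has
    length at least 1. *)
Lemma input_bounds : let B := input_size (enc_ris I) in
  [/\ (0 < B)%N, (nsets I <= B)%N, (size (items I) <= B)%N &
      (#|forbid I| <= B)%N].
Proof.
have arith (a b c x y : nat) : (a <= x -> 2 * b + c + x.+1 < y ->
  [/\ 0 < y, b <= y, c <= y & a <= y])%N by move=> *; split; lia.
move=> B; have: (size (enc_ris I) <= B)%N := size_input _.
rewrite enc_risE /= size_cat size_enc_sets /= size_enum_ord -/(items I).
have := size_enc_tuples (enum (forbid I)); rewrite -cardE.
exact: arith.
Qed.

Lemma ris_run : forbidden_transitive I ->
  let s := start (enc_ris I) in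
  loops_le (input_size (enc_ris I)) ris_cmd s /\
  ris_answer I (sout (run ris_cmd s)).
Proof.
move=> tr; set B := input_size _; have [B0 mB nB tB] := input_bounds.
have rB i : (nitems i <= B)%N by apply: leq_trans nB; apply: nitems_le_n.
move=> s; have [l1 [sN p1] i1 sM pP] := read_sets_ok tuples_input mB rB.
rewrite -[start _]/s in l1 sN p1 i1 sM pP.
set s1 := run read_sets s in l1 sN p1 i1 sM pP.
have z1 A z : ~~ writes read_sets A -> s1 A z = 0 by move=> h; rewrite /s1 run_frame.
have t1 : tuples_ok (I := I) [::] s1.
  split=> a; last by rewrite z1.
  have [_ _ h _] := p1 a (mem_items a).
  exists a => //; split=> [|b]; rewrite /near /linked ?eqxx //= orbF => /eqP->//.
have so1 i : s1 aOFF (i : nat)%:Z = (off I i)%:Z.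
  by case: (pP i).
have i1' : sinp s1 = (size (enum (forbid I)))%:Z ::
    flatten [seq enc_tuple t | t <- enum (forbid I)] by rewrite -cardE.
have tB' : (size (enum (forbid I)) <= B)%N by rewrite -cardE.
have [l2 [r2 b2]] := read_tuples_ok tB' so1 t1 i1'.
set s2 := run read_tuples s1 in l2 r2 b2.
have fr2 A z : ~~ writes read_tuples A -> s2 A z = s1 A z by apply: run_frame.
have sN2 : s2 aN 0 = size (items I) by rewrite fr2.
have sM2 : s2 aM 0 = nsets I by rewrite fr2.
have rw := rows_ok sN2 sM2 _; set s3 := run rows s2 in rw.
have fr3 A z : ~~ writes rows A -> s3 A z = s2 A z by apply: run_frame.
have st : static I s3.
  split=> [||i|i|a].
  - by rewrite fr3.
  - by rewrite fr3.
  - by rewrite fr3 // fr2 //; case: (pP i).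
  - by apply: rw; rewrite fr2 // z1.
  - have [h1 h2 _ _] := p1 a (mem_items a).
    rewrite !fr3 // (fr2 aS) // (fr2 aC) // b2 mem_enum /good negbK; split=> //.
    by have [b -> /idx_rep->] := r2 a.
(* Memory starts at 0, which provides the empty matching, [v = 0] and a cleared failure flag. *)
have zero A z : ~~ writes (Seq read_sets (Seq read_tuples rows)) A -> s3 A z = 0.
  by case/norP=> h1 /norP[h2 h3]; rewrite fr3 // fr2 // z1.
have sv : partial (@npick I) (run solve s3).
  apply: solve_ok => // [|i a <-|q|q]; [exact: zero| |exact: zero|exact: zero].
  by rewrite fr3 // fr2 //; have [] := p1 a (mem_items a).
have sN3 : s3 aN 0 = size (items I) by rewrite fr3.
have sM3 : s3 aM 0 = nsets I by rewrite fr3.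
set s4 := run solve s3 in sv.
have fr4 A z : ~~ writes solve A -> s4 A z = s3 A z by apply: run_frame.
have so4 : sout s4 = [::].
  by rewrite /s4 run_sout // /s3 run_sout // /s2 run_sout // /s1 run_sout.
(* After reading, every loop is limited by the number of items or of sets, and neither is written
   again. *)
have lim (c : cmd) (t : state) : within (pred2 aN aM) c ->
    ~~ writes c aN -> ~~ writes c aM ->
    t aN 0 = size (items I) -> t aM 0 = nsets I -> loops_le B c t.
  move=> wc cN cM tN tM; apply: (within_loops_le wc) => N /orP[]/eqP->.
    by rewrite tN.
  by rewrite tM.
have l3 : loops_le B rows s2 by exact: lim.
have l4 : loops_le B solve s3 by exact: lim.
have sN4 : s4 aN 0 = size (items I) by rewrite fr4.
have sM4 : s4 aM 0 = nsets I by rewrite fr4.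
have l5 : loops_le B print_answer s4 by clearbody s4; exact: lim.
split; first exact: (conj l1 (conj l2 (conj l3 (conj l4 l5)))).
have -> : run ris_cmd s = run print_answer s4.
  rewrite /ris_cmd (run_seq read_sets) -/s1 (run_seq read_tuples) -/s2.
  by rewrite (run_seq rows) -/s3 (run_seq solve).
clearbody s4.
case: sv => st4 [[sF [X [u [v [du ma sl cX]]]]]|[sF no]]; last first.
  right; split; last by rewrite /print_answer run_if [ev _ _]/= sF /= so4.
  by move=> x /(feasible_picks tr) /no.
left; exists (sel (chosen (@rep I) X)); last exact: print_answer_ok.
have pX : picks (@tag _ _) (@rep I) (@good I) (@npick I) (chosen (@rep I) X).
  by apply: chosen_picks cX; case: sl.
split; first exact: picks_feasible.
move=> y /(feasible_picks tr) py; rewrite !value_unsel.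
have -> : \sum_a cst a * (unsel (sel (chosen (@rep I) X)) a : nat)%:Z =
    \sum_a cst a * (chosen (@rep I) X a : nat)%:Z.
  by apply: eq_bigr => a _; rewrite selK.
exact: slack_optimal sl cX py.
Qed.

End Answer.

Lemma horner_scale_exp (a d B : nat) : (a *: 'X^d : {poly nat}).[B] = (a * B ^ d)%N.
Proof. by rewrite hornerZ hornerXn natrXE. Qed.

Lemma transitive_solvable : polytime_solvable enc_ris ris_answer forbidden_transitive.
Proof.
have [a [d time_le]] := time_bound_poly ris_cmd.
(* The time bound is taken with the input size for [B], which gives one polynomial for all
   instances. *)
exists (compile 0 ris_cmd), (a *: 'X^d) => I tr.
have [lim ans] := ris_run tr; eexists; last exact: ans.
have [B0 _ _ _] := input_bounds I.
have := compile_halts ris_cmd_wf lim; rewrite horner_scale_exp.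
by move=> h; apply: halts_within_le h _; apply: time_le.
Qed.

(** The two forbidden pairs come from tuples containing [b], hence from a single tuple; each of the
    four orientations then forces [a = c]. *)
Lemma at_most_one_transitive I : at_most_one_tuple I -> forbidden_transitive I.
Proof.
move=> h1 a b c ac; have {}h1 t t' : t \in forbid I -> t' \in forbid I ->
    (b == t.1) || (b == t.2) -> (b == t'.1) || (b == t'.2) -> t = t'.
  move=> ht ht' bt bt'; have /card_le1_eqP := h1 b; apply.
    by rewrite inE ht'.
  by rewrite inE ht.
move=> /orP[] h /orP[] h'; have := h1 _ _ h h'; rewrite /= !eqxx ?orbT;
  by move=> /(_ isT isT) e; case/eqP: ac; congruence.
Qed.

Theorem theorem2 :
  polytime_solvable enc_ris ris_answer at_most_one_tuple /\
  polytime_solvable enc_ris ris_answer forbidden_transitive.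
Proof.
(* One program and one polynomial serve both classes. *)
have [P [q h]] := transitive_solvable; split; exists P, q => I hI; apply: h => //.
exact: at_most_one_transitive.
Qed.
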